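(* Let $b>\theta\ge 2$ be integers. Let $W_p$, $p_{\mathrm T}$, $q_{\mathrm T}$ and $Q_p(t)$ (continuous-time dynamics) be as defined in the context, and for small $h>0$ let $p_h:=p_{\mathrm T}+h$. Set $$\alpha:=\frac{\pi}{\sqrt{\tfrac12 W_{p_{\mathrm T}}''(q_{\mathrm T})}}\sqrt{\frac{1-p_{\mathrm T}}{1-q_{\mathrm T}}}.$$ Then for each $r\in\mathbb R$ the limit $$\phi(r):=\lim_{h\downarrow 0}Q_{p_h}\bigl(\alpha h^{-1/2}+r\bigr)$$ exists, and $\phi$ is a solution of the ODE $$\phi'(r)=W_{p_{\mathrm T}}\bigl(\phi(r)\bigr),\qquad r\in\mathbb R,$$ subject to the boundary conditions $$\lim_{r\to-\infty}\phi(r)=q_{\mathrm T}\quad\text{and}\quad \lim_{r\to\infty}\phi(r)=1 .$$ (The solution of this boundary value problem is determined uniquely up to a shift of the argument.) Equivalently, for $q\in(q_{\mathrm T},1)$, if $t_h(q)$ is defined by $Q_{p_h}(t_h(q))=q$, then $$t_h(q)-\alpha h^{-1/2}\ \underset{h\downarrow 0}{\longrightarrow}\ \phi^{-1}(q),\qquad q_{\mathrm T}<q<1 .$$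
   Context: For integers $m,\theta\ge 1$ and $q\in[0,1]$, $\mathrm{Bin}(m,q,\theta):=\sum_{k=\theta}^{m}\binom mk q^k(1-q)^{m-k}$ is the probability that a sum of $m$ i.i.d. Bernoulli($q$) variables is at least $\theta$. For $p\in(0,1)$ set $$W_p(q):=p+(1-p)\,\mathrm{Bin}(b,q,\theta)-q,\qquad q\in[0,1].$$ For $b>\theta\ge2$ there is $\tilde p\in(0,1)$ such that for every $p\in(0,\tilde p)$ the function $q\mapsto W_p(q)$ has exactly one local minimizer in the open interval $(0,1)$, denoted $q_{\min}(p)$ (whereas for $p>\tilde p$ the function $W_p$ is decreasing on $[0,1]$). The number $p_{\mathrm T}\in(0,\tilde p)$ is the unique value of $p\in(0,\tilde p)$ with $W_p(q_{\min}(p))=0$, and $q_{\mathrm T}:=q_{\min}(p_{\mathrm T})$. For $p\in(0,1)$, the function $Q_p:[0,\infty)\to[0,1]$ is the unique $[0,1]$-valued solution of $$Q_p(t)=p+(1-p)\int_0^t e^{-(t-z)}\,\mathrm{Bin}\bigl(b,Q_p(z),\theta\bigr)\,dz,\qquad t\ge0;$$ equivalently, $Q_p(0)=p$ and $\frac{d}{dt}Q_p(t)=W_p(Q_p(t))$. (It is the probability that, in continuous-time bootstrap percolation with threshold $\theta$ and i.i.d. Bernoulli($p$) initial condition on the rooted tree in which every vertex has $b$ children, the root is occupied by time $t$; in this dynamics a vacant vertex becomes occupied at rate $1$ whenever it has at least $\theta$ occupied neighbors, and occupied vertices stay occupied.) *)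

(* Defs.v *)
From Stdlib Require Import Reals.
From Coquelicot Require Import Coquelicot.

Open Scope R_scope.

(* [Binomial.C] is the binomial coefficient; the unqualified [C] is
   Coquelicot's type of complex numbers. *)
Definition Bin (m : nat) (q : R) (theta : nat) : R :=
  sum_n_m (fun k => Binomial.C m k * q ^ k * (1 - q) ^ (m - k)) theta m.

Definition W (b theta : nat) (p q : R) : R :=
  p + (1 - p) * Bin b q theta - q.

Definition local_minimizer01 (f : R -> R) (q : R) : Prop :=
  0 < q < 1 /\ locally q (fun x => f q <= f x).

Definition decreasing01 (f : R -> R) : Prop :=
  forall x y, 0 <= x -> x < y -> y <= 1 -> f y < f x.

Definition is_min_threshold (b theta : nat) (pt : R) (qmin : R -> R) : Prop :=
  0 < pt < 1 /\
  (forall p, 0 < p < pt -> unique (local_minimizer01 (W b theta p)) (qmin p)) /\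
  (forall p, pt < p < 1 -> decreasing01 (W b theta p)).

Definition is_transition (b theta : nat) (pT qT : R) : Prop :=
  exists (pt : R) (qmin : R -> R),
    is_min_threshold b theta pt qmin /\
    unique (fun p => 0 < p < pt /\ W b theta p (qmin p) = 0) pT /\
    qT = qmin pT.

(* Only the values of [Q] on [0, +oo) matter.  A bounded measurable
   solution is automatically continuous on [0, +oo), so asking for Riemann integrability
   loses no solution. *)
Definition is_occupation_prob (b theta : nat) (p : R) (Q : R -> R) : Prop :=
  forall t, 0 <= t ->
    0 <= Q t <= 1 /\
    ex_RInt (fun z => exp (- (t - z)) * Bin b (Q z) theta) 0 t /\
    Q t = p + (1 - p) *
              RInt (fun z => exp (- (t - z)) * Bin b (Q z) theta) 0 t.

Definition alpha (b theta : nat) (pT qT : R) : R :=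
  PI / sqrt (1 / 2 * Derive_n (W b theta pT) 2 qT)
  * sqrt ((1 - pT) / (1 - qT)).

Definition solves_bvp (b theta : nat) (pT qT : R) (phi : R -> R) : Prop :=
  (forall r, is_derive phi r (W b theta pT (phi r))) /\
  is_lim phi m_infty qT /\
  is_lim phi p_infty 1.

(* Main.v *)
Require Import Defs.
From Stdlib Require Import Reals Lra Lia.
From Coquelicot Require Import Coquelicot.

Open Scope R_scope.

(* Since [Q_p] increases along [q' = W_p(q)], it is the inverse of the hitting
   time [T_p(q)], the integral of [1 / W_p] from [p] to [q].  For [p = pT + h],
   [W_p = W_pT + h (1 - Bin)], and [W_pT] vanishes only at [qT] in [0, 1), to
   second order.  With [x = s - qT], the integrand near [qT] is
   [1 / (a x^2 + c h)], whose integral is [pi / sqrt (a c h)] up to a convergent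
   term, plus an odd term of the next order, which integrates to zero over
   symmetric windows, plus a bounded remainder; outside the window the integral
   converges.  Letting the window shrink shows that
   [T_(pT + h)(q) - alpha / sqrt h] converges for [qT < q < 1].  The limit is an
   antiderivative of [1 / W_pT] that diverges at both ends, and [phi] is its
   inverse. *)

(** * Polynomial functions and binomial tails *)

(* Closed under pointwise equality, so that no extensionality axiom is needed. *)
Inductive is_poly : (R -> R) -> Prop :=
| is_poly_const c : is_poly (fun _ => c)
| is_poly_id : is_poly (fun x => x)
| is_poly_plus f g : is_poly f -> is_poly g -> is_poly (fun x => f x + g x)
| is_poly_mult f g : is_poly f -> is_poly g -> is_poly (fun x => f x * g x)
| is_poly_ext f g : is_poly f -> (forall x, f x = g x) -> is_poly g.

Lemma is_poly_pow f n : is_poly f -> is_poly (fun x => f x ^ n).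
Proof.
intros Hf; induction n as [|n IH]; simpl.
- apply is_poly_const.
- now apply is_poly_mult.
Qed.

Lemma is_poly_minus f g :
  is_poly f -> is_poly g -> is_poly (fun x => f x - g x).
Proof.
intros Hf Hg; apply is_poly_ext with (fun x => f x + (-1) * g x).
- apply is_poly_plus, is_poly_mult; auto using is_poly_const.
- intros x; ring.
Qed.

Lemma is_poly_sum_n_m (f : nat -> R -> R) n m :
  (forall k, is_poly (f k)) -> is_poly (fun x => sum_n_m (fun k => f k x) n m).
Proof.
intros Hf; induction m as [|m IH].
- destruct n as [|n].
  + apply is_poly_ext with (f 0%nat); auto.
    intros x; now rewrite sum_n_n.
  + apply is_poly_ext with (fun _ => 0); [apply is_poly_const|].
    intros x; rewrite sum_n_m_zero; [reflexivity|lia].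
- destruct (Compare_dec.le_lt_dec n (S m)) as [Hn|Hn].
  + apply is_poly_ext with (fun x => sum_n_m (fun k => f k x) n m + f (S m) x).
    * now apply is_poly_plus.
    * intros x; now rewrite sum_n_Sm.
  + apply is_poly_ext with (fun _ => 0); [apply is_poly_const|].
    intros x; rewrite sum_n_m_zero; [reflexivity|lia].
Qed.

Lemma is_poly_derive f :
  is_poly f -> exists df, is_poly df /\ forall x, is_derive f x (df x).
Proof.
induction 1 as [c| |f g Hf [df [Pf Df]] Hg [dg [Pg Dg]]
                |f g Hf [df [Pf Df]] Hg [dg [Pg Dg]]|f g Hf [df [Pf Df]] E].
- exists (fun _ => 0); split; [apply is_poly_const|].
  intros x; apply (@is_derive_const R_AbsRing).
- exists (fun _ => 1); split; [apply is_poly_const|].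
  intros x; apply (@is_derive_id R_AbsRing).
- exists (fun x => df x + dg x); split; [now apply is_poly_plus|].
  intros x; apply (is_derive_plus f g); auto.
- exists (fun x => df x * g x + f x * dg x); split.
  + apply is_poly_plus; apply is_poly_mult; auto.
  + intros x; apply (is_derive_mult f g); auto; intros; apply Rmult_comm.
- exists df; split; auto.
  intros x; now apply is_derive_ext with f.
Qed.

Lemma is_poly_continuous f x : is_poly f -> continuous f x.
Proof.
intros Hf; destruct (is_poly_derive f Hf) as [df [_ Df]].
apply (ex_derive_continuous f); now exists (df x).
Qed.

(** Division by [x - x0] with a quotient that is again polynomial, so it can be iterated. The
    product case splits [f1 f2 - f1(x0) f2(x0)] as [(f1 - f1(x0)) f2 + f1(x0) (f2 - f2(x0))]. *)
Lemma is_poly_factor f x0 : is_poly f ->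
  exists g, is_poly g /\ forall x, f x = f x0 + (x - x0) * g x.
Proof.
induction 1 as [c| |f1 f2 H1 [g1 [P1 E1]] H2 [g2 [P2 E2]]
                |f1 f2 H1 [g1 [P1 E1]] H2 [g2 [P2 E2]]|f g Hf [g1 [P1 E1]] E].
- exists (fun _ => 0); split; [apply is_poly_const|intros; ring].
- exists (fun _ => 1); split; [apply is_poly_const|intros; ring].
- exists (fun x => g1 x + g2 x); split; [now apply is_poly_plus|].
  intros x; rewrite (E1 x), (E2 x); ring.
- exists (fun x => g1 x * f2 x + f1 x0 * g2 x); split.
  + apply is_poly_plus; apply is_poly_mult; auto using is_poly_const.
  + intros x; rewrite (E1 x) at 1; rewrite (E2 x) at 1.
    rewrite (E2 x); ring.
- exists g1; split; auto.
  intros x; now rewrite <- !E.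
Qed.

Lemma is_poly_bounded f M : is_poly f ->
  exists K, 0 <= K /\ forall x, Rabs x <= M -> Rabs (f x) <= K.
Proof.
induction 1 as [c| |f g Hf [K1 [P1 B1]] Hg [K2 [P2 B2]]
                |f g Hf [K1 [P1 B1]] Hg [K2 [P2 B2]]|f g Hf [K1 [P1 B1]] E].
- exists (Rabs c); split; [apply Rabs_pos|intros; lra].
- exists (Rabs M); split; [apply Rabs_pos|intros x Hx].
  generalize (Rle_abs M); lra.
- exists (K1 + K2); split; [lra|intros x Hx].
  generalize (Rabs_triang (f x) (g x)) (B1 x Hx) (B2 x Hx); lra.
- exists (K1 * K2); split; [nra|intros x Hx].
  rewrite Rabs_mult; apply Rmult_le_compat; auto using Rabs_pos.
- exists K1; split; auto.
  intros x; rewrite <- E; auto.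
Qed.

Lemma is_derive_factor f g x0 : is_poly g ->
  (forall x, f x = f x0 + (x - x0) * g x) -> is_derive f x0 (g x0).
Proof.
intros Pg E; destruct (is_poly_derive g Pg) as [dg [_ Dg]].
apply is_derive_ext with (fun x => f x0 + (x - x0) * g x).
- intros t; now rewrite <- E.
- auto_derive; [now exists (dg x0)|ring].
Qed.

(** Four successive divisions by [x - x0]. The remainder is a polynomial multiple of [x ^ 4], hence
    continuous and bounded on bounded sets, while the cubic coefficient [e] stays separate because
    its contribution must cancel by oddness. *)
Lemma is_poly_taylor f f' f'' x0 : is_poly f ->
  (forall x, is_derive f x (f' x)) -> is_derive f' x0 f'' ->
  exists e g, is_poly g /\ forall x,
    f (x0 + x) = f x0 + f' x0 * x + f'' / 2 * x ^ 2 + e * x ^ 3 + x ^ 4 * g x.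
Proof.
intros Pf D1 D2.
destruct (is_poly_factor f x0 Pf) as [g1 [P1 E1]].
destruct (is_poly_factor g1 x0 P1) as [g2 [P2 E2]].
destruct (is_poly_factor g2 x0 P2) as [g3 [P3 E3]].
destruct (is_poly_factor g3 x0 P3) as [g4 [P4 E4]].
assert (F1 : g1 x0 = f' x0).
{ rewrite <- (is_derive_unique _ _ _ (D1 x0)); symmetry.
  apply is_derive_unique; now apply is_derive_factor. }
destruct (is_poly_derive g1 P1) as [dg1 [Q1 G1]].
destruct (is_poly_derive dg1 Q1) as [ddg1 [_ GG1]].
assert (G1x : dg1 x0 = g2 x0).
{ rewrite <- (is_derive_unique _ _ _ (G1 x0)).
  apply is_derive_unique; now apply is_derive_factor. }
(* Differentiating [f = f x0 + (x - x0) g1] gives [f' = g1 + (x - x0) g1']; a second derivative at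
   [x0] counts [g1' x0 = g2 x0] twice. *)
assert (F2 : f'' = 2 * g2 x0).
{ rewrite <- G1x, <- (is_derive_unique _ _ _ D2).
  apply is_derive_unique.
  apply is_derive_ext with (fun x => g1 x + (x - x0) * dg1 x).
  - intros x; rewrite <- (is_derive_unique _ _ _ (D1 x)); symmetry.
    apply is_derive_unique.
    apply is_derive_ext with (fun x => f x0 + (x - x0) * g1 x).
    + intros t; now rewrite <- E1.
    + auto_derive; [now exists (dg1 x)|].
      replace (Derive (fun t => g1 t) x) with (dg1 x)
        by (symmetry; apply is_derive_unique, G1); ring.
  - auto_derive.
    + repeat split; [now exists (dg1 x0)|now exists (ddg1 x0)].
    + replace (Derive (fun t => g1 t) x0) with (dg1 x0)
        by (symmetry; apply is_derive_unique, G1); ring. }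
exists (g3 x0), (fun x => g4 (x0 + x)); split.
- clear -P4.
  induction P4.
  + apply is_poly_const.
  + apply is_poly_plus; [apply is_poly_const|apply is_poly_id].
  + now apply (is_poly_plus (fun x => f (x0 + x)) (fun x => g (x0 + x))).
  + now apply (is_poly_mult (fun x => f (x0 + x)) (fun x => g (x0 + x))).
  + now apply (is_poly_ext (fun x => f (x0 + x))).
- intros x.
  rewrite E1, E2, E3, E4, F1, F2; field_simplify; ring.
Qed.

Lemma is_poly_lipschitz f M : is_poly f ->
  exists K, 0 <= K /\ forall x y, Rabs x <= M -> Rabs y <= M ->
    Rabs (f x - f y) <= K * Rabs (x - y).
Proof.
intros Pf; destruct (is_poly_derive f Pf) as [df [Pd D]].
destruct (is_poly_bounded df M Pd) as [K [K0 HK]].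
exists K; split; auto; intros x y Hx Hy.
destruct (MVT_gen f y x df) as [c [Hc E]].
- intros; apply D.
- intros t _; apply continuity_pt_filterlim, is_poly_continuous, Pf.
- rewrite E, Rabs_mult; apply Rmult_le_compat_r; [apply Rabs_pos|].
  apply HK; revert Hc Hx Hy; unfold Rmin, Rmax, Rabs.
  destruct (Rle_dec y x), (Rcase_abs x), (Rcase_abs y), (Rcase_abs c); lra.
Qed.

Lemma is_poly_Bin m theta : is_poly (fun q => Bin m q theta).
Proof.
unfold Bin.
apply (is_poly_sum_n_m
  (fun k q => Binomial.C m k * q ^ k * (1 - q) ^ (m - k))).
intros k; apply is_poly_mult; [apply is_poly_mult|].
- apply is_poly_const.
- apply is_poly_pow, is_poly_id.
- apply is_poly_pow, is_poly_minus; [apply is_poly_const|apply is_poly_id].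
Qed.

(** Raises the threshold by one, with [Bin_full] as the end point; the facts below on [Bin] are
    proved by induction on the distance from the threshold to [m]. *)
Lemma Bin_succ m q k : (k < m)%nat ->
  Bin m q k = Binomial.C m k * q ^ k * (1 - q) ^ (m - k) + Bin m q (S k).
Proof. intros Hk; unfold Bin; rewrite sum_Sn_m; [reflexivity|lia]. Qed.

Lemma Bin_full m q : Bin m q m = q ^ m.
Proof.
unfold Bin; rewrite sum_n_n, Nat.sub_diag, Rcomplements.C_n_n; simpl; ring.
Qed.

Lemma Binomial_C_succ m k : (k < m)%nat ->
  INR (S k) * Binomial.C m (S k) = INR (m - k) * Binomial.C m k.
Proof.
intros Hk; unfold Binomial.C.
replace (m - k)%nat with (S (m - S k)) by lia.
rewrite !fact_simpl, !mult_INR; field.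
repeat split; try apply INR_fact_neq_0; apply not_0_INR; lia.
Qed.

(* The derivatives of consecutive summands telescope. *)
Lemma is_derive_Bin m k q : (k < m)%nat ->
  is_derive (fun q => Bin m q (S k)) q
    (INR (S k) * Binomial.C m (S k) * (q ^ k * (1 - q) ^ (m - S k))).
Proof.
intros Hk.
remember (m - S k)%nat as j eqn:Hj; revert k Hk Hj.
induction j as [|j IH]; intros k Hk Hj.
- assert (m = S k) by lia; subst m.
  apply is_derive_ext with (fun q => q ^ S k).
  + intros t; now rewrite Bin_full.
  + auto_derive; auto.
    rewrite Rcomplements.C_n_n, pow_O.
    change (1 * (INR (S k) * q ^ k) = INR (S k) * 1 * (q ^ k * 1)); ring.
- apply is_derive_ext with (fun q =>
    Binomial.C m (S k) * q ^ S k * (1 - q) ^ S j + Bin m q (S (S k))).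
  + intros t; rewrite (Bin_succ m t (S k)) by lia.
    now replace (m - S k)%nat with (S j) by lia.
  + evar_last.
    * apply (is_derive_plus
        (fun q => Binomial.C m (S k) * q ^ S k * (1 - q) ^ S j)
        (fun q => Bin m q (S (S k)))).
      -- auto_derive; auto.
      -- apply IH; lia.
    * rewrite (Binomial_C_succ m (S k)) by lia.
      replace (m - S k)%nat with (S j) by lia.
change (Binomial.C m (S k) * (1 * (INR (S k) * q ^ k))
          * ((1 - q) * (1 - q) ^ j)
        + Binomial.C m (S k) * (q * q ^ k) * (- (1) * (INR (S j) * (1 - q) ^ j))
        + INR (S j) * Binomial.C m (S k) * (q * q ^ k * (1 - q) ^ j)
        = INR (S k) * Binomial.C m (S k) * (q ^ k * ((1 - q) * (1 - q) ^ j))).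
      ring.
Qed.

Lemma Bin_0 m k : (S k <= m)%nat -> Bin m 0 (S k) = 0.
Proof.
intros Hk.
remember (m - S k)%nat as j eqn:Hj; revert k Hk Hj.
induction j as [|j IH]; intros k Hk Hj.
- replace (S k) with m by lia; rewrite Bin_full; apply pow_i; lia.
- rewrite Bin_succ, IH by lia; rewrite pow_i by lia; ring.
Qed.

Lemma Bin_1 m k : (k <= m)%nat -> Bin m 1 k = 1.
Proof.
intros Hk.
remember (m - k)%nat as j eqn:Hj; revert k Hk Hj.
induction j as [|j IH]; intros k Hk Hj.
- replace k with m by lia; rewrite Bin_full; apply pow1.
- rewrite Bin_succ, IH by lia.
  rewrite Rminus_diag, (pow_i (m - k)) by lia; ring.
Qed.

Lemma Binomial_C_pos m k : 0 < Binomial.C m k.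
Proof.
unfold Binomial.C; apply Rdiv_lt_0_compat; [|apply Rmult_lt_0_compat];
  apply INR_fact_lt_0.
Qed.

(** * The integral through the bottleneck *)

Lemma RInt_odd (f : R -> R) delta : ex_RInt f (- delta) delta ->
  (forall x, f (- x) = - f x) -> RInt f (- delta) delta = 0.
Proof.
intros Hf Hodd.
pose proof (RInt_correct (V := R_CompleteNormedModule) f _ _ Hf) as I1.
assert (I2 : is_RInt f delta (- delta) (RInt f (- delta) delta)).
{ apply is_RInt_ext with (fun y => opp (f (- y))).
  - intros x _; rewrite Hodd; unfold opp; simpl; ring.
  - apply (is_RInt_comp_opp (V := R_NormedModule)).
    now rewrite Ropp_involutive. }
apply (is_RInt_swap (V := R_NormedModule)) in I2.
apply (is_RInt_unique (V := R_CompleteNormedModule)) in I2.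
revert I2; unfold opp; simpl; lra.
Qed.

(* The subtracted odd term is the first-order effect of the perturbation; it
   integrates to zero over symmetric intervals. *)
Lemma reciprocal_expansion a c e d M h x g k :
  0 < a -> 0 < c -> 0 < h -> Rabs g <= M -> Rabs k <= M ->
  let K := (Rabs e + M) / a + (Rabs d + M) / c + 1 in
  let D := a * x ^ 2 + c * h in
  let N := D + x * (e * x ^ 2 + d * h) + x ^ 2 * (x ^ 2 * g + h * k) in
  Rabs x <= / (4 * K) ->
  0 < N /\
  Rabs (/ N - / D + x * (e * x ^ 2 + d * h) / D ^ 2) <= 2 * (K + 2 * K ^ 2) / a.
Proof.
intros Ha Hc Hh Hg Hk K D N Hx.
assert (M0 : 0 <= M) by (generalize (Rabs_pos g); lra).
assert (Ka : Rabs e + M <= K * a /\ Rabs d + M <= K * c /\ 1 <= K).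
{ unfold K; generalize (Rabs_pos e) (Rabs_pos d); intros E0 D0.
  assert (0 <= (Rabs e + M) / a) by (apply Rcomplements.Rdiv_le_0_compat; lra).
  assert (0 <= (Rabs d + M) / c) by (apply Rcomplements.Rdiv_le_0_compat; lra).
  repeat split; [| |lra].
  - replace (Rabs e + M) with ((Rabs e + M) / a * a) at 1 by (field; lra).
    apply Rmult_le_compat_r; lra.
  - replace (Rabs d + M) with ((Rabs d + M) / c * c) at 1 by (field; lra).
    apply Rmult_le_compat_r; lra. }
destruct Ka as [Ke [Kd K1]]; clearbody K.
assert (X2 : 0 <= x ^ 2) by apply pow2_ge_0.
assert (D0 : 0 < D) by (unfold D; nra).
(* Both [x ^ 2] and [h] are controlled by [D], uniformly in [h]; this is the purpose of the two
   quotients in [K]. *)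
assert (bound : forall s t, Rabs s <= K * a -> Rabs t <= K * c ->
          Rabs ((s * x ^ 2 + t * h) / D) <= K).
{ intros s t Hs Ht; unfold Rdiv; rewrite Rabs_mult.
  rewrite (Rabs_pos_eq (/ D)) by (left; now apply Rinv_0_lt_compat).
  apply Rmult_le_reg_r with D; auto.
  rewrite Rmult_assoc, Rinv_l, Rmult_1_r by lra.
  eapply Rle_trans; [apply Rabs_triang|]; rewrite !Rabs_mult.
  rewrite (Rabs_pos_eq h), (Rabs_pos_eq (x ^ 2)) by lra; unfold D; nra. }
pose proof (Rabs_pos e); pose proof (Rabs_pos d).
assert (Hp : Rabs ((e * x ^ 2 + d * h) / D) <= K) by (apply bound; lra).
assert (Hs : Rabs ((g * x ^ 2 + k * h) / D) <= K) by (apply bound; lra).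
set (p := (e * x ^ 2 + d * h) / D) in *.
set (s := (g * x ^ 2 + k * h) / D) in *.
assert (Hx' : K * Rabs x <= / 4).
{ apply Rmult_le_compat_l with (r := K) in Hx; [|lra].
  replace (K * / (4 * K)) with (/ 4) in Hx by (field; lra); lra. }
pose proof (Rabs_pos x) as X0.
assert (X4 : Rabs x <= / 4) by nra.
assert (Xp : Rabs (x * p) <= / 4).
{ rewrite Rabs_mult; generalize (Rabs_pos p); nra. }
assert (Xs : Rabs (x ^ 2 * s) <= / 4).
{ rewrite Rabs_mult, <- RPow_abs; generalize (Rabs_pos s); intros.
  apply Rle_trans with ((Rabs x * K) * Rabs x); [simpl|nra].
  rewrite Rmult_1_r, (Rmult_comm (_ * _)), <- Rmult_assoc, (Rmult_comm (Rabs s)).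
  apply Rmult_le_compat_r; nra. }
(* [n] is the ratio [N / D]. The radius [/ (4 * K)] makes each of its two corrections at most a
   quarter, so [n] stays above one half. *)
set (n := 1 + x * p + x ^ 2 * s).
assert (n2 : / 2 <= n).
{ apply Rcomplements.Rabs_le_between in Xp, Xs; unfold n; lra. }
assert (EN : N = D * n) by (unfold N, n, p, s; field; lra).
split; [rewrite EN; apply Rmult_lt_0_compat; lra|].
(* The numerator [1 - n + x p n] loses its term of order [x]; the factor [x ^ 2] that remains
   cancels the singularity, since [x ^ 2 / D <= / a]. *)
replace (/ N - / D + x * (e * x ^ 2 + d * h) / D ^ 2)
  with (x ^ 2 / D * (/ n) * (- s + p ^ 2 + x * p * s)).
2:{ rewrite EN.
    replace (e * x ^ 2 + d * h) with (p * D) by (unfold p; field; lra).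
    replace (/ (D * n) - / D + x * (p * D) / D ^ 2)
      with ((1 - n + x * p * n) / (D * n)) by (field; lra).
    unfold n at 2 3; field; lra. }
rewrite !Rabs_mult.
replace (2 * (K + 2 * K ^ 2) / a) with (/ a * 2 * (K + 2 * K ^ 2)) by (field; lra).
apply Rmult_le_compat; [|apply Rabs_pos| |].
- apply Rmult_le_pos; apply Rabs_pos.
- apply Rmult_le_compat; try apply Rabs_pos.
  + rewrite Rabs_pos_eq by (apply Rcomplements.Rdiv_le_0_compat; lra).
    apply Rmult_le_reg_r with (a * D); [nra|].
    replace (x ^ 2 / D * (a * D)) with (a * x ^ 2) by (field; lra).
    replace (/ a * (a * D)) with D by (field; lra).
    unfold D; nra.
  + rewrite Rabs_pos_eq by (left; apply Rinv_0_lt_compat; lra).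
    replace 2 with (/ / 2) by field; apply Rinv_le_contravar; lra.
- eapply Rle_trans; [apply Rabs_triang|].
  eapply Rle_trans; [apply Rplus_le_compat_r, Rabs_triang|].
  rewrite Rabs_Ropp, <- RPow_abs, !Rabs_mult.
  generalize (Rabs_pos p) (Rabs_pos s); intros.
  assert (Rabs p ^ 2 <= K ^ 2) by (apply pow_incr; lra).
  assert (Rabs x * Rabs p * Rabs s <= 1 * K * K); [|nra].
  apply Rmult_le_compat; [nra|lra| |lra].
  apply Rmult_le_compat; lra.
Qed.

(** The point is that [M] does not depend on [h]: adding the odd function leaves the integral
    unchanged and turns the difference of the integrands into one bounded uniformly in [h]. *)
Lemma RInt_bottleneck a c e d (g k : R -> R) :
  0 < a -> 0 < c -> is_poly g -> is_poly k ->
  exists M delta0, 0 <= M /\ 0 < delta0 /\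
  forall delta h, 0 < delta <= delta0 -> 0 < h ->
    Rabs (RInt (fun x => / ((a * x ^ 2 + e * x ^ 3 + x ^ 4 * g x)
                       + h * (c + d * x + x ^ 2 * k x))) (- delta) delta
          - RInt (fun x => / (a * x ^ 2 + c * h)) (- delta) delta) <= M * delta.
Proof.
intros Ha Hc Pg Pk.
(* Bounds on [-1, 1] suffice, because the window [/ (4 * K)] is at most a quarter. *)
destruct (is_poly_bounded g 1 Pg) as [M1 [M10 HM1]].
destruct (is_poly_bounded k 1 Pk) as [M2 [M20 HM2]].
set (M := M1 + M2).
set (K := (Rabs e + M) / a + (Rabs d + M) / c + 1).
assert (K1 : 1 <= K).
{ unfold K; generalize (Rabs_pos e) (Rabs_pos d); intros E0 D0.
  assert (0 <= (Rabs e + M) / a)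
    by (apply Rcomplements.Rdiv_le_0_compat; unfold M; lra).
  assert (0 <= (Rabs d + M) / c)
    by (apply Rcomplements.Rdiv_le_0_compat; unfold M; lra).
  lra. }
assert (K4 : 0 < / (4 * K) <= / 4).
{ split; [apply Rinv_0_lt_compat; lra|apply Rinv_le_contravar; lra]. }
exists (2 * (2 * (K + 2 * K ^ 2) / a)), (/ (4 * K)).
split; [|split; [lra|]].
{ apply Rmult_le_pos; [lra|]; apply Rcomplements.Rdiv_le_0_compat; nra. }
intros delta h Hdelta Hh.
pose (D := fun x => a * x ^ 2 + c * h).
pose (N := fun x => (a * x ^ 2 + e * x ^ 3 + x ^ 4 * g x)
                      + h * (c + d * x + x ^ 2 * k x)).
pose (O := fun x => x * (e * x ^ 2 + d * h) / D x ^ 2).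
assert (D0 : forall x, 0 < D x).
{ intros x; unfold D; generalize (pow2_ge_0 x); nra. }
assert (key : forall x, - delta <= x <= delta ->
   0 < N x /\ Rabs (/ N x - / D x + O x) <= 2 * (K + 2 * K ^ 2) / a).
{ intros x Hx.
  assert (Hx4 : Rabs x <= / (4 * K)) by (apply Rabs_le; lra).
  destruct (reciprocal_expansion a c e d M h x (g x) (k x)) as [P1 P2]; auto.
  - unfold M; generalize (HM1 x); lra.
  - unfold M; generalize (HM2 x); lra.
  - fold K in P2.
    replace (a * x ^ 2 + c * h + x * (e * x ^ 2 + d * h)
               + x ^ 2 * (x ^ 2 * g x + h * k x)) with (N x) in P1, P2
      by (unfold N; ring).
    auto. }
assert (PN : is_poly N).
{ unfold N.
  repeat first [apply is_poly_plus | assumption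
    | apply (is_poly_pow (fun x => x)) | apply is_poly_id | apply is_poly_const
    | apply is_poly_mult]. }
assert (PD : is_poly D).
{ unfold D.
  repeat first [apply is_poly_plus | apply is_poly_const | apply is_poly_mult
    | apply (is_poly_pow (fun x => x)) | apply is_poly_id]. }
assert (IN : ex_RInt (fun x => / N x) (- delta) delta).
{ apply (ex_RInt_continuous (V := R_CompleteNormedModule)); intros x Hx.
  rewrite Rmin_left, Rmax_right in Hx by lra.
  apply continuous_Rinv_comp; [now apply is_poly_continuous|].
  generalize (key x Hx); lra. }
assert (ID : ex_RInt (fun x => / D x) (- delta) delta).
{ apply (ex_RInt_continuous (V := R_CompleteNormedModule)); intros x Hx.
  apply continuous_Rinv_comp; [now apply is_poly_continuous|].
  generalize (D0 x); lra. }
assert (IO : ex_RInt O (- delta) delta).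
{ apply (ex_RInt_continuous (V := R_CompleteNormedModule)); intros x Hx.
  apply (ex_derive_continuous O); unfold O, D.
  auto_derive; generalize (D0 x); unfold D; intros D0x.
  apply (pow_nonzero (a * x ^ 2 + c * h) 2); lra. }
assert (IO0 : RInt O (- delta) delta = 0).
{ apply RInt_odd; auto; intros x; unfold O, D; field.
  generalize (D0 x); unfold D; lra. }
fold (D); change (Rabs (RInt (fun x => / N x) (- delta) delta
          - RInt (fun x => / D x) (- delta) delta)
   <= 2 * (2 * (K + 2 * K ^ 2) / a) * delta).
replace (RInt (fun x => / N x) (- delta) delta
          - RInt (fun x => / D x) (- delta) delta)
  with (RInt (fun x => / N x - / D x + O x) (- delta) delta).
- eapply Rle_trans; [apply abs_RInt_le_const|].
  + lra.
  + apply (ex_RInt_plus (V := R_NormedModule)); auto.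
    now apply (ex_RInt_minus (V := R_NormedModule)).
  + intros x Hx; now apply key.
  + lra.
- transitivity (RInt (fun x => / N x - / D x) (- delta) delta
                + RInt O (- delta) delta).
  + apply (RInt_plus (V := R_CompleteNormedModule)); auto.
    now apply (ex_RInt_minus (V := R_NormedModule)).
  + rewrite IO0, Rplus_0_r.
    now apply (RInt_minus (V := R_CompleteNormedModule)).
Qed.

(** The antiderivative is an arctangent of an argument that tends to infinity as [h] vanishes.
    Passing to the reciprocal argument isolates [PI / 2], the source of the divergent term, from a
    small correction. *)
Lemma RInt_lorentz a c h delta : 0 < a -> 0 < c -> 0 < h -> 0 < delta ->
  RInt (fun x => / (a * x ^ 2 + c * h)) (- delta) delta
  = 2 / (sqrt (a * c) * sqrt h)
    * (PI / 2 - atan (sqrt (a * c) / (delta * a) * sqrt h)).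
Proof.
intros Ha Hc Hh Hdelta.
assert (b0 : 0 < sqrt (a * c)) by (apply sqrt_lt_R0; nra).
assert (v0 : 0 < sqrt h) by now apply sqrt_lt_R0.
assert (bb : sqrt (a * c) ^ 2 = a * c) by (rewrite pow2_sqrt; nra).
assert (vv : sqrt h ^ 2 = h) by (rewrite pow2_sqrt; lra).
set (b := sqrt (a * c)) in *; set (v := sqrt h) in *.
assert (b * v <> 0) by nra.
pose (A := fun x => / (b * v) * atan (a / (b * v) * x)).
assert (I : is_RInt (fun x => / (a * x ^ 2 + c * h)) (- delta) delta
              (minus (A delta) (A (- delta)))).
{ apply (is_RInt_derive (V := R_CompleteNormedModule) A).
  - intros x _; unfold A.
    assert (0 < 1 + (a / (b * v) * x) ^ 2)
      by (generalize (pow2_ge_0 (a / (b * v) * x)); lra).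
    evar_last.
    + apply (is_derive_scal (fun x => atan (a / (b * v) * x))).
      apply (is_derive_comp atan (fun x => a / (b * v) * x)).
      * apply is_derive_atan.
      * auto_derive; [auto|reflexivity].
    + unfold scal; simpl; unfold mult; simpl.
      rewrite <- vv, Rsqr_pow2.
      assert (0 < a * x ^ 2 + c * v ^ 2)
        by (generalize (pow2_ge_0 x) (pow_lt v 2 v0); nra).
      assert (E : 1 + (a / (b * v) * x) ^ 2 = (a * x ^ 2 + c * v ^ 2) / (c * v ^ 2)).
      { replace ((a / (b * v) * x) ^ 2) with (a ^ 2 * x ^ 2 / (b ^ 2 * v ^ 2))
          by (field; lra).
        rewrite bb; field; lra. }
      rewrite E.
      transitivity (a * c / b ^ 2 * / (a * x ^ 2 + c * v ^ 2)).
      * field; repeat split; lra.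
      * rewrite bb; field; lra.
  - intros x _; apply (continuous_Rinv_comp (fun x => a * x ^ 2 + c * h)).
    + apply (ex_derive_continuous (fun x => a * x ^ 2 + c * h)); auto_derive; auto.
    + generalize (pow2_ge_0 x); nra. }
rewrite (is_RInt_unique (V := R_CompleteNormedModule) _ _ _ _ I).
unfold minus, plus, opp; simpl; unfold A.
replace (a / (b * v) * - delta) with (- (a / (b * v) * delta)) by ring.
rewrite atan_opp.
replace (a / (b * v) * delta) with (/ (b / (delta * a) * v)) by (field; lra).
rewrite atan_inv; [field; lra|].
apply Rmult_lt_0_compat; auto; apply Rdiv_lt_0_compat; nra.
Qed.

Lemma filterlim_sqrt_at_right_0 : filterlim sqrt (at_right 0) (at_right 0).
Proof.
intros P [eps HP].
assert (e2 : 0 < eps ^ 2) by (apply pow_lt, cond_pos).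
exists (mkposreal _ e2); intros h Hh h0; apply HP.
- change (Rabs (sqrt h - 0) < eps); change (Rabs (h - 0) < eps ^ 2) in Hh.
  rewrite Rminus_0_r in *; rewrite Rabs_pos_eq in * by (try apply sqrt_pos; lra).
  apply Rsqr_incrst_0; [|apply sqrt_pos|left; apply cond_pos].
  rewrite Rsqr_sqrt, Rsqr_pow2; lra.
- now apply sqrt_lt_R0.
Qed.

Lemma atan_slope k :
  filterlim (fun v => atan (k * v) / v) (at_right 0) (locally k).
Proof.
assert (D : is_derive (fun v => atan (k * v)) 0 k).
{ evar_last.
  - apply (is_derive_comp atan (fun x => k * x)).
    + apply is_derive_atan.
    + auto_derive; [auto|reflexivity].
  - unfold scal; simpl; unfold mult; simpl; rewrite Rmult_0_r.
    unfold Rsqr; field. }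
apply is_derive_Reals in D.
apply filterlim_locally; intros eps.
destruct (D eps (cond_pos eps)) as [delta Hd].
exists delta; intros v Hv v0.
change (Rabs (v - 0) < delta) in Hv; rewrite Rminus_0_r in Hv.
specialize (Hd v (Rgt_not_eq _ _ v0) Hv).
rewrite Rplus_0_l, Rmult_0_r, atan_0, Rminus_0_r in Hd; exact Hd.
Qed.

(** [PI / sqrt (a * c) * / sqrt h] is the integral over the whole line; the limit is minus the
    integral of [1 / (a x^2)] outside the window. *)
Lemma RInt_lorentz_asympt a c delta : 0 < a -> 0 < c -> 0 < delta ->
  filterlim (fun h => RInt (fun x => / (a * x ^ 2 + c * h)) (- delta) delta
                      - PI / sqrt (a * c) * / sqrt h)
    (at_right 0) (locally (- (2 / (delta * a)))).
Proof.
intros Ha Hc Hdelta.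
assert (b0 : 0 < sqrt (a * c)) by (apply sqrt_lt_R0; nra).
set (b := sqrt (a * c)) in *.
apply filterlim_ext_loc with
  (fun h => (- (2 / b)) * (atan (b / (delta * a) * sqrt h) / sqrt h)).
- exists (mkposreal _ Rlt_0_1); intros h _ h0.
  assert (v0 : 0 < sqrt h) by now apply sqrt_lt_R0.
  rewrite RInt_lorentz by auto; fold b; field; lra.
- replace (- (2 / (delta * a))) with ((- (2 / b)) * (b / (delta * a)))
    by (field; lra).
  apply (filterlim_comp _ _ _ (fun h => atan (b / (delta * a) * sqrt h) / sqrt h)
           (fun y => (- (2 / b)) * y) _ (locally (b / (delta * a)))).
  + apply (filterlim_comp _ _ _ sqrt (fun v => atan (b / (delta * a) * v) / v)
             _ (at_right 0)).
    * apply filterlim_sqrt_at_right_0.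
    * apply atan_slope.
  + apply (ex_derive_continuous (fun y => - (2 / b) * y)); auto_derive; auto.
Qed.

(** Integrates the pointwise sandwich [1/w - h H/w^2 <= 1/(w + h H) <= 1/w], so the error is at most
    [h] times a fixed integral. *)
Lemma RInt_perturbed_limit (w H : R -> R) l u : l <= u ->
  (forall x, l <= x <= u -> continuous w x /\ continuous H x) ->
  (forall x, l <= x <= u -> 0 < w x /\ 0 <= H x) ->
  filterlim (fun h => RInt (fun x => / (w x + h * H x)) l u)
    (at_right 0) (locally (RInt (fun x => / w x) l u)).
Proof.
intros Hlu HC HP.
assert (Iw : ex_RInt (fun x => / w x) l u).
{ apply (ex_RInt_continuous (V := R_CompleteNormedModule)); intros x Hx.
  rewrite Rmin_left, Rmax_right in Hx by lra.
  apply continuous_Rinv_comp; [now apply HC|generalize (HP x Hx); lra]. }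
assert (IH : ex_RInt (fun x => H x * (/ w x * / w x)) l u).
{ apply (ex_RInt_continuous (V := R_CompleteNormedModule)); intros x Hx.
  rewrite Rmin_left, Rmax_right in Hx by lra.
  assert (continuous (fun x => / w x) x).
  { apply continuous_Rinv_comp; [now apply HC|generalize (HP x Hx); lra]. }
  apply (continuous_mult H (fun x => / w x * / w x)); [now apply HC|].
  now apply (continuous_mult (fun x => / w x) (fun x => / w x)). }
set (M := RInt (fun x => H x * (/ w x * / w x)) l u) in *.
assert (M0 : 0 <= M).
{ apply RInt_ge_0; auto; intros x Hx.
  destruct (HP x) as [P1 P2]; [lra|].
  apply Rinv_0_lt_compat in P1; apply Rmult_le_pos; nra. }
apply filterlim_locally; intros eps.
assert (d0 : 0 < eps / (M + 1)) by (apply Rdiv_lt_0_compat; [apply cond_pos|lra]).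
exists (mkposreal _ d0); intros h Hh h0.
change (Rabs (h - 0) < eps / (M + 1)) in Hh.
rewrite Rminus_0_r, Rabs_pos_eq in Hh by lra.
assert (Ih : ex_RInt (fun x => / (w x + h * H x)) l u).
{ apply (ex_RInt_continuous (V := R_CompleteNormedModule)); intros x Hx.
  rewrite Rmin_left, Rmax_right in Hx by lra.
  apply (continuous_Rinv_comp (fun x => w x + h * H x)).
  - apply (continuous_plus w (fun x => h * H x)); [now apply HC|].
    apply (continuous_mult (fun _ => h) H); [apply continuous_const|now apply HC].
  - generalize (HP x Hx); nra. }
change (Rabs (RInt (fun x => / (w x + h * H x)) l u - RInt (fun x => / w x) l u)
         < eps).
assert (B1 : RInt (fun x => / (w x + h * H x)) l u <= RInt (fun x => / w x) l u).
{ apply RInt_le; auto; intros x Hx; destruct (HP x) as [P1 P2]; [lra|].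
  apply Rinv_le_contravar; nra. }
assert (B2 : RInt (fun x => / w x - h * (H x * (/ w x * / w x))) l u
             <= RInt (fun x => / (w x + h * H x)) l u).
{ apply RInt_le; auto.
  - apply (ex_RInt_minus (V := R_NormedModule) (fun x => / w x)
             (fun x => h * (H x * (/ w x * / w x)))); auto.
    now apply (ex_RInt_scal (V := R_NormedModule) (fun x => H x * (/ w x * / w x))).
  - intros x Hx; destruct (HP x) as [P1 P2]; [lra|].
    assert (0 < w x + h * H x) by nra.
    apply Rminus_le_0.
    replace (/ (w x + h * H x) - (/ w x - h * (H x * (/ w x * / w x))))
      with ((h * H x) ^ 2 / ((w x + h * H x) * w x ^ 2)) by (field; lra).
    apply Rcomplements.Rdiv_le_0_compat; [apply pow2_ge_0|].
    apply Rmult_lt_0_compat; auto; now apply pow_lt. }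
assert (E : RInt (fun x => / w x - h * (H x * (/ w x * / w x))) l u
            = RInt (fun x => / w x) l u - h * M).
{ unfold M; rewrite <- (RInt_scal (V := R_CompleteNormedModule)) by auto.
  apply (RInt_minus (V := R_CompleteNormedModule) (fun x => / w x)
             (fun x => h * (H x * (/ w x * / w x)))); auto.
  now apply (ex_RInt_scal (V := R_NormedModule) (fun x => H x * (/ w x * / w x))). }
rewrite E in B2.
assert (h * M < eps).
{ apply Rle_lt_trans with (h * (M + 1)); [nra|].
  apply Rmult_lt_compat_r with (r := M + 1) in Hh; [|lra].
  replace (eps / (M + 1) * (M + 1)) with (pos eps) in Hh by (field; lra); lra. }
apply Rabs_def1; lra.
Qed.

(** A function eventually within every [eps] of some convergent function is Cauchy. The approximant
    may change with [eps], as it does when the window shrinks. *)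
Lemma filterlim_approx (F : (R -> Prop) -> Prop) {FF : ProperFilter F} (f : R -> R) :
  (forall eps, 0 < eps -> exists (E : R -> R) l,
     filterlim E F (locally l) /\ F (fun h => Rabs (f h - E h) <= eps)) ->
  exists l, filterlim f F (locally l).
Proof.
intros Hf; apply (filterlim_locally_cauchy (U := R_CompleteSpace)); intros eps.
assert (e4 : 0 < eps / 4) by (generalize (cond_pos eps); lra).
destruct (Hf (eps / 4) e4) as [E [l [HE Hfe]]].
exists (fun h => Rabs (f h - E h) <= eps / 4 /\ ball l (mkposreal _ e4) (E h)).
split.
- apply filter_and; auto.
  now apply (proj1 (filterlim_locally E l)).
- intros h h' [H1 H2] [H3 H4].
  change (Rabs (E h - l) < eps / 4) in H2; change (Rabs (E h' - l) < eps / 4) in H4.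
  change (Rabs (f h' - f h) < eps).
  apply Rcomplements.Rabs_lt_between in H2, H4.
  apply Rcomplements.Rabs_le_between in H1, H3.
  apply Rabs_def1; lra.
Qed.

(* Away from the origin the integral converges; near it only [a] and [c]
   matter, up to an error proportional to the width of the window. *)
Lemma passage_time_asympt (w H g k : R -> R) a c e d l u :
  0 < a -> 0 < c -> l < 0 < u -> is_poly g -> is_poly k ->
  (forall x, w x = a * x ^ 2 + e * x ^ 3 + x ^ 4 * g x) ->
  (forall x, H x = c + d * x + x ^ 2 * k x) ->
  (forall x, l <= x <= u -> x <> 0 -> 0 < w x) ->
  (forall x, l <= x <= u -> 0 < H x) ->
  exists L, filterlim
    (fun h => RInt (fun x => / (w x + h * H x)) l u - PI / sqrt (a * c) * / sqrt h)
    (at_right 0) (locally L).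
Proof.
intros Ha Hc Hlu Pg Pk Ew EH Pw PH.
destruct (RInt_bottleneck a c e d g k Ha Hc Pg Pk) as [M [delta0 [M0 [d0 HM]]]].
assert (Cw : forall x, continuous w x).
{ intros x; apply is_poly_continuous.
  apply is_poly_ext with (fun x => a * x ^ 2 + e * x ^ 3 + x ^ 4 * g x); auto.
  repeat first [assumption | apply is_poly_const | apply (is_poly_pow (fun x => x))
    | apply is_poly_id | apply is_poly_plus | apply is_poly_mult]. }
assert (CH : forall x, continuous H x).
{ intros x; apply is_poly_continuous.
  apply is_poly_ext with (fun x => c + d * x + x ^ 2 * k x); auto.
  repeat first [assumption | apply is_poly_const | apply (is_poly_pow (fun x => x))
    | apply is_poly_id | apply is_poly_plus | apply is_poly_mult]. }
apply filterlim_approx; [apply at_right_proper_filter|].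
intros eps He.
(* The window fits into [[l, u]] and into the range of the bottleneck estimate, and [M * delta] is
   below [eps]; [M + 1] avoids dividing by zero. *)
set (delta := Rmin delta0 (Rmin (- l) (Rmin u (eps / (M + 1))))).
assert (e0 : 0 < eps / (M + 1)) by (apply Rdiv_lt_0_compat; lra).
assert (Hd : 0 < delta) by (repeat apply Rmin_glb_lt; lra).
assert (Hd1 : delta <= delta0) by apply Rmin_l.
assert (Hd2 : delta <= - l /\ delta <= u /\ delta <= eps / (M + 1)).
{ unfold delta; generalize (Rmin_r delta0 (Rmin (- l) (Rmin u (eps / (M + 1)))))
   (Rmin_l (- l) (Rmin u (eps / (M + 1)))) (Rmin_r (- l) (Rmin u (eps / (M + 1))))
   (Rmin_l u (eps / (M + 1))) (Rmin_r u (eps / (M + 1))); lra. }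
clearbody delta.
(* The approximant replaces the integrand by the Lorentzian inside the window only, so each of its
   three parts has a known limit. *)
exists (fun h => RInt (fun x => / (w x + h * H x)) l (- delta)
          + (RInt (fun x => / (a * x ^ 2 + c * h)) (- delta) delta
               - PI / sqrt (a * c) * / sqrt h)
          + RInt (fun x => / (w x + h * H x)) delta u).
exists (RInt (fun x => / w x) l (- delta) + - (2 / (delta * a))
          + RInt (fun x => / w x) delta u).
split.
- assert (side : forall s t, l <= s <= t -> t <= u ->
     (forall x, s <= x <= t -> x <> 0) ->
     filterlim (fun h => RInt (fun x => / (w x + h * H x)) s t)
       (at_right 0) (locally (RInt (fun x => / w x) s t))).
  { intros s t Hst Ht H0; apply RInt_perturbed_limit; [lra|auto|].
    intros x Hx; split; [apply Pw; auto; lra|left; apply PH; lra]. }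
  refine (filterlim_comp_2 _ _ Rplus _ _ (filterlim_plus (V := R_NormedModule) _ _));
    [refine (filterlim_comp_2 _ _ Rplus _ _ (filterlim_plus (V := R_NormedModule) _ _))|].
  + apply side; intros; lra.
  + now apply RInt_lorentz_asympt.
  + apply side; intros; lra.
- exists (mkposreal _ Rlt_0_1); intros h _ h0.
  assert (I : forall s t, l <= s <= t -> t <= u ->
     ex_RInt (fun x => / (w x + h * H x)) s t).
  { intros s t Hst Ht; apply (ex_RInt_continuous (V := R_CompleteNormedModule)).
    intros x Hx; rewrite Rmin_left, Rmax_right in Hx by lra.
    apply (continuous_Rinv_comp (fun x => w x + h * H x)).
    - apply (continuous_plus w (fun x => h * H x)); auto.
      apply (continuous_mult (fun _ => h) H); auto; apply continuous_const.
    - assert (0 < H x) by (apply PH; lra).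
      destruct (Req_dec x 0) as [->|x0].
      + rewrite Ew; simpl; nra.
      + assert (0 < w x) by (apply Pw; auto; lra); nra. }
  assert (E : RInt (fun x => / (w x + h * H x)) l u
      = RInt (fun x => / (w x + h * H x)) l (- delta)
        + RInt (fun x => / (w x + h * H x)) (- delta) delta
        + RInt (fun x => / (w x + h * H x)) delta u).
  { rewrite <- (RInt_Chasles (V := R_CompleteNormedModule) _ l delta u)
      by (apply I; lra).
    rewrite <- (RInt_Chasles (V := R_CompleteNormedModule) _ l (- delta) delta)
      by (apply I; lra).
    reflexivity. }
  specialize (HM delta h (conj Hd Hd1) h0).
  rewrite (RInt_ext (V := R_CompleteNormedModule) _ (fun x => / (w x + h * H x))) in HM
    by (intros; now rewrite Ew, EH).
  rewrite E; apply Rle_trans with (M * delta).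
  + eapply Rle_trans; [right|exact HM]; f_equal; ring.
  + apply Rle_trans with (M * (eps / (M + 1))); [apply Rmult_le_compat_l; lra|].
    replace (M * (eps / (M + 1))) with (eps - eps / (M + 1)) by (field; lra).
    lra.
Qed.

(** * The drift at the transition *)

Lemma Bin_increasing m k x y : (k < m)%nat -> 0 <= x -> x < y -> y <= 1 ->
  Bin m x (S k) < Bin m y (S k).
Proof.
intros Hk Hx Hxy Hy.
destruct (MVT_cor2 (fun q => Bin m q (S k))
   (fun q => INR (S k) * Binomial.C m (S k) * (q ^ k * (1 - q) ^ (m - S k))) x y)
  as [z [E Hz]]; [lra| |].
- intros z _; now apply is_derive_Reals, is_derive_Bin.
- apply Rlt_0_minus; rewrite E.
  apply Rmult_lt_0_compat; [|lra].
  apply Rmult_lt_0_compat; apply Rmult_lt_0_compat.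
  + apply lt_0_INR; lia.
  + apply Binomial_C_pos.
  + apply pow_lt; lra.
  + apply pow_lt; lra.
Qed.

Lemma Bin_lt_1 m k q : (k < m)%nat -> 0 <= q < 1 -> Bin m q (S k) < 1.
Proof.
intros Hk Hq; rewrite <- (Bin_1 m (S k)) by lia.
apply Bin_increasing; auto; lra.
Qed.

Lemma Bin_pos m k q : (k < m)%nat -> 0 < q <= 1 -> 0 < Bin m q (S k).
Proof.
intros Hk Hq; rewrite <- (Bin_0 m k) by lia.
apply Bin_increasing; auto; lra.
Qed.

(** The derivative is factored so that its sign on (0, 1) is that of an affine function of [q],
    whose root is the inflection point. *)
Lemma is_derive2_Bin m k q : (S k < m)%nat ->
  is_derive (fun q => INR (S (S k)) * Binomial.C m (S (S k))
                      * (q ^ S k * (1 - q) ^ S (m - S (S (S k))))) q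
    (INR (S (S k)) * Binomial.C m (S (S k)) * (q ^ k * (1 - q) ^ (m - S (S (S k))))
     * (INR (S k) * (1 - q) - INR (S (m - S (S (S k)))) * q)).
Proof.
intros Hk; set (j := (m - S (S (S k)))%nat).
set (K := INR (S (S k)) * Binomial.C m (S (S k))).
evar_last; [auto_derive; auto|].
change (K * (1 * (INR (S k) * q ^ k) * ((1 - q) * (1 - q) ^ j)
             + q * q ^ k * (- (1) * (INR (S j) * (1 - q) ^ j)))
  = K * (q ^ k * (1 - q) ^ j) * (INR (S k) * (1 - q) - INR (S j) * q)).
ring.
Qed.

Lemma W_1 m k p : (k <= m)%nat -> W m k p 1 = 0.
Proof. intros Hk; unfold W; rewrite Bin_1 by auto; ring. Qed.

(* [W] is convex and then concave; the minimizer lies strictly to the left of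
   the inflection point, since at that point [W] could only be decreasing. *)
Lemma W_at_tangency b theta p q0 : (2 <= theta < b)%nat -> 0 < p < 1 ->
  local_minimizer01 (W b theta p) q0 -> W b theta p q0 = 0 ->
  exists w1 w2 : R -> R,
    (forall q, is_derive (W b theta p) q (w1 q)) /\
    (forall q, is_derive w1 q (w2 q)) /\
    w1 q0 = 0 /\ 0 < w2 q0 /\
    (forall q, 0 <= q < 1 -> q <> q0 -> 0 < W b theta p q).
Proof.
intros Ht Hp [Hq0 Hmin] HW0.
destruct theta as [|[|k]]; [lia|lia|].
assert (Hk : (S k < b)%nat) by lia.
set (j := (b - S (S (S k)))%nat).
set (K := INR (S (S k)) * Binomial.C b (S (S k))).
pose (w := W b (S (S k)) p).
pose (w1 := fun q => (1 - p) * (K * (q ^ S k * (1 - q) ^ S j)) - 1).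
pose (w2 := fun q => (1 - p) * (K * (q ^ k * (1 - q) ^ j)
                                * (INR (S k) * (1 - q) - INR (S j) * q))).
assert (D1 : forall q, is_derive w q (w1 q)).
{ intros q; pose proof (is_derive_Bin b (S k) q Hk) as D.
  replace (b - S (S k))%nat with (S j) in D by lia.
  evar_last.
  - apply (is_derive_minus (fun q => p + (1 - p) * Bin b q (S (S k))) (fun q => q)).
    + apply (is_derive_plus (fun _ => p) (fun q => (1 - p) * Bin b q (S (S k)))).
      * apply (@is_derive_const R_AbsRing).
      * apply (is_derive_scal (fun q => Bin b q (S (S k)))), D.
    + apply (@is_derive_id R_AbsRing).
  - change (0 + (1 - p) * (K * (q ^ S k * (1 - q) ^ S j)) + - (1) = w1 q).
    unfold w1; ring. }
assert (D2 : forall q, is_derive w1 q (w2 q)).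
{ intros q; pose proof (is_derive2_Bin b k q Hk) as D; fold j K in D.
  unfold w1, w2.
  evar_last.
  - apply (is_derive_minus (fun q => (1 - p) * (K * (q ^ S k * (1 - q) ^ S j)))
             (fun _ => 1)).
    + apply (is_derive_scal (fun q => K * (q ^ S k * (1 - q) ^ S j))), D.
    + apply (@is_derive_const R_AbsRing).
  - change ((1 - p) * (K * (q ^ k * (1 - q) ^ j)
                         * (INR (S k) * (1 - q) - INR (S j) * q)) + - (0)
      = (1 - p) * (K * (q ^ k * (1 - q) ^ j)
                     * (INR (S k) * (1 - q) - INR (S j) * q))).
    ring. }
exists w1, w2; fold w; fold w in HW0, Hmin.
assert (M1 : forall x y, x < y -> exists z, w y - w x = w1 z * (y - x) /\ x < z < y).
{ intros x y Hxy; apply MVT_cor2; auto; intros; now apply is_derive_Reals. }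
assert (M2 : forall x y, x < y -> exists z, w1 y - w1 x = w2 z * (y - x) /\ x < z < y).
{ intros x y Hxy; apply MVT_cor2; auto; intros; now apply is_derive_Reals. }
assert (K0 : 0 < K).
{ unfold K; apply Rmult_lt_0_compat; [apply lt_0_INR; lia|apply Binomial_C_pos]. }
clearbody K.
assert (k0 : 0 < INR (S k)) by (apply lt_0_INR; lia).
assert (j0 : 0 < INR (S j)) by (apply lt_0_INR; lia).
set (qs := INR (S k) / (INR (S k) + INR (S j))).
assert (Eqs : forall q, INR (S k) * (1 - q) - INR (S j) * q
                = (INR (S k) + INR (S j)) * (qs - q)).
{ intros q; unfold qs; field; lra. }
assert (S1 : forall q, 0 < q < 1 -> exists c, 0 < c /\ w2 q = c * (qs - q)).
{ intros q Hq.
  exists ((1 - p) * (K * (q ^ k * (1 - q) ^ j)) * (INR (S k) + INR (S j))); split.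
  - apply Rmult_lt_0_compat; [|lra].
    repeat apply Rmult_lt_0_compat; auto; try lra; apply pow_lt; lra.
  - unfold w2; rewrite Eqs; ring. }
assert (qs1 : 0 < qs < 1).
{ unfold qs; split.
  - apply Rdiv_lt_0_compat; lra.
  - apply Rmult_lt_reg_r with (INR (S k) + INR (S j)); [lra|].
    unfold Rdiv; rewrite Rmult_assoc, Rinv_l; lra. }
assert (Inc : forall x y, 0 <= x < y -> y <= qs -> w1 x < w1 y).
{ intros x y Hx Hy; destruct (M2 x y) as [z [E Hz]]; [lra|].
  destruct (S1 z) as [c [c0 Ec]]; [lra|]; rewrite Ec in E.
  apply Rlt_0_minus; rewrite E; repeat apply Rmult_lt_0_compat; lra. }
assert (Dec : forall x y, qs <= x < y -> y <= 1 -> w1 y < w1 x).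
{ intros x y Hx Hy; destruct (M2 x y) as [z [E Hz]]; [lra|].
  destruct (S1 z) as [c [c0 Ec]]; [lra|]; rewrite Ec in E.
  assert (0 < c * (z - qs) * (y - x))
    by (repeat apply Rmult_lt_0_compat; lra).
  lra. }
assert (Z1 : w1 q0 = 0).
{ destruct Hmin as [eps He].
  assert (D : derivable_pt_lim w q0 (w1 q0)) by now apply is_derive_Reals.
  generalize (cond_pos eps); intros eps0.
  pose proof (deriv_minimum w (q0 - eps) (q0 + eps) q0 (exist _ _ D)) as E.
  apply E; try lra.
  intros x Hx1 Hx2; apply He; change (Rabs (x - q0) < eps); apply Rabs_def1; lra. }
assert (Hqs : q0 < qs).
{ destruct (Rlt_le_dec q0 qs) as [|Hle]; auto; exfalso.
  destruct Hmin as [eps He]; generalize (cond_pos eps); intros eps0.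
  (* Capped at 1, since [w1] is known to decrease only up to there. *)
  set (x := Rmin (q0 + eps / 2) 1).
  assert (Hx : q0 < x <= 1 /\ x <= q0 + eps / 2).
  { unfold x; repeat split; [apply Rmin_glb_lt; lra|apply Rmin_r|apply Rmin_l]. }
  destruct (M1 q0 x) as [z [E Hz]]; [lra|].
  assert (w1 z < 0) by (rewrite <- Z1; apply Dec; lra).
  assert (w q0 <= w x) by (apply He; change (Rabs (x - q0) < eps);
    apply Rabs_def1; lra).
  nra. }
split; [exact D1|split; [exact D2|split; [exact Z1|split]]].
- destruct (S1 q0) as [c [c0 ->]]; auto; nra.
- intros q Hq Hne.
  destruct (Rlt_le_dec q q0) as [Hlt|Hge].
  { destruct (M1 q q0) as [z [E Hz]]; auto.
    assert (w1 z < 0) by (rewrite <- Z1; apply Inc; lra); nra. }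
  assert (Hmid : forall x, q0 < x <= qs -> 0 < w x).
  { intros x Hx; destruct (M1 q0 x) as [z [E Hz]]; [lra|].
    assert (0 < w1 z) by (rewrite <- Z1; apply Inc; lra); nra. }
  destruct (Rle_lt_dec q qs) as [Hle|Hgt]; [apply Hmid; lra|].
  (* Beyond the inflection point, a nonpositive value forces a negative slope between [qs] and [q].
     Concavity keeps the slope negative up to 1, which contradicts [w 1 = 0]. *)
  destruct (Rlt_le_dec 0 (w q)) as [|Hneg]; auto; exfalso.
  assert (0 < w qs) by (apply Hmid; lra).
  assert (W1 : w 1 = 0) by (apply W_1; lia).
  destruct (M1 qs q) as [z1 [E1 Hz1]]; [lra|].
  destruct (M1 q 1) as [z2 [E2 Hz2]]; [lra|].
  assert (w1 z2 < w1 z1) by (apply Dec; lra).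
  assert (w1 z1 < 0) by nra.
  assert (w1 z2 < 0) by lra.
  nra.
Qed.


Lemma W_shift b theta p h q :
  W b theta (p + h) q = W b theta p q + h * (1 - Bin b q theta).
Proof. unfold W; ring. Qed.

Lemma is_poly_W b theta p : is_poly (W b theta p).
Proof.
unfold W; apply is_poly_minus; [|apply is_poly_id].
apply is_poly_plus; [apply is_poly_const|].
apply is_poly_mult; [apply is_poly_const|apply is_poly_Bin].
Qed.

(** * Hitting times *)

(** Factoring [exp (- t)] out of the convolution leaves the integral [J] of a function independent
    of [t]. Regularity is then bootstrapped: integrability makes [J] continuous, hence [Qe] and [F]
    are continuous, hence [J] is differentiable. *)
Lemma occupation_ode b theta p Q : is_occupation_prob b theta p Q ->
  exists Qe : R -> R, (forall t, 0 <= t -> Qe t = Q t) /\ Qe 0 = p /\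
    forall t, 0 <= t -> is_derive Qe t (W b theta p (Qe t)).
Proof.
intros HQ.
(* The maximum extends [Q] to the left of 0, making derivatives at 0 two-sided. *)
pose (F := fun z => exp z * Bin b (Q (Rmax 0 z)) theta).
assert (IF0 : forall t, ex_RInt F 0 t).
{ intros t; destruct (Rle_lt_dec 0 t) as [Ht|Ht].
  - destruct (HQ t Ht) as [_ [I _]].
    apply (ex_RInt_ext (V := R_NormedModule))
      with (fun z => scal (exp t) (exp (- (t - z)) * Bin b (Q z) theta)).
    + intros x; rewrite Rmin_left, Rmax_right by lra; intros Hx.
      unfold scal; simpl; unfold mult; simpl; unfold F.
      rewrite (Rmax_right 0 x) by lra.
      rewrite <- Rmult_assoc, <- exp_plus; do 2 f_equal; ring.
    + now apply (ex_RInt_scal (V := R_NormedModule)).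
  - apply (ex_RInt_ext (V := R_NormedModule))
      with (fun z => exp z * Bin b (Q 0) theta).
    + intros x; rewrite Rmin_right, Rmax_left by lra; intros Hx.
      unfold F; now rewrite (Rmax_left 0 x) by lra.
    + apply (ex_RInt_continuous (V := R_CompleteNormedModule)); intros z _.
      apply (ex_derive_continuous (fun z => exp z * Bin b (Q 0) theta)).
      auto_derive; auto. }
pose (J := fun t => RInt F 0 t).
pose (Qe := fun t => p + (1 - p) * (exp (- t) * J t)).
assert (IJ : forall t, is_RInt F 0 t (J t)).
{ intros t; apply (RInt_correct (V := R_CompleteNormedModule)), IF0. }
assert (CJ : forall t, continuous J t).
{ intros t; apply (continuous_RInt_1 (V := R_NormedModule) F 0).
  apply filter_forall; intros z; apply IJ. }
assert (EQ : forall t, 0 <= t -> Qe t = Q t).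
{ intros t Ht; destruct (HQ t Ht) as [_ [I E]]; rewrite E; unfold Qe, J.
  do 2 f_equal.
  rewrite <- (RInt_scal (V := R_CompleteNormedModule) F) by apply IF0.
  apply (RInt_ext (V := R_CompleteNormedModule)); intros z.
  rewrite Rmin_left, Rmax_right by lra; intros Hz.
  unfold scal; simpl; unfold mult; simpl; unfold F.
  rewrite (Rmax_right 0 z) by lra.
  rewrite <- Rmult_assoc, <- exp_plus; do 2 f_equal; ring. }
assert (CQ : forall t, continuous Qe t).
{ intros t; unfold Qe.
  apply (continuous_plus (fun _ => p) (fun t => (1 - p) * (exp (- t) * J t)));
    [apply continuous_const|].
  apply (continuous_mult (fun _ => 1 - p) (fun t => exp (- t) * J t));
    [apply continuous_const|].
  apply (continuous_mult (fun t => exp (- t)) J); auto.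
  apply (ex_derive_continuous (fun t => exp (- t))); auto_derive; auto. }
(* The maximum with 0 is written as [(z + Rabs z) / 2], from which continuity at 0 is immediate. *)
assert (CF : forall t, continuous F t).
{ intros t; apply continuous_ext with
    (fun z => exp z * Bin b (Qe ((z + Rabs z) / 2)) theta).
  - intros z.
    assert (Ez : (z + Rabs z) / 2 = Rmax 0 z).
    { unfold Rmax, Rabs; destruct (Rle_dec 0 z), (Rcase_abs z); lra. }
    unfold F; rewrite Ez, EQ; [reflexivity|apply Rmax_l].
  - apply (continuous_mult exp (fun z => Bin b (Qe ((z + Rabs z) / 2)) theta));
      [apply continuous_exp|].
    apply (continuous_comp (fun z => Qe ((z + Rabs z) / 2)) (fun q => Bin b q theta));
      [|apply is_poly_continuous, is_poly_Bin].
    apply (continuous_comp (fun z => (z + Rabs z) / 2) Qe); auto.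
    apply (continuous_mult (fun z => z + Rabs z) (fun _ => / 2));
      [|apply continuous_const].
    apply (continuous_plus (fun z => z) Rabs);
      [apply continuous_id|apply continuous_Rabs]. }
assert (DJ : forall t, is_derive J t (F t)).
{ intros t; apply (is_derive_RInt (V := R_NormedModule) F J 0); auto.
  apply filter_forall; intros z; apply IJ. }
exists Qe; split; [exact EQ|split].
- unfold Qe, J; rewrite (RInt_point (V := R_CompleteNormedModule)).
  unfold zero; simpl; ring.
- intros t Ht.
  replace (W b theta p (Qe t))
    with ((1 - p) * (- exp (- t) * J t + exp (- t) * F t)).
  + unfold Qe at 1; auto_derive; [now exists (F t)|].
    replace (Derive (fun x => J x) t) with (F t)
      by (symmetry; apply is_derive_unique, DJ).
    ring.
  + unfold F; rewrite (Rmax_right 0 t), <- EQ by auto.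
    assert (Ee : exp (- t) * exp t = 1) by (now rewrite <- exp_plus, Rplus_opp_l, exp_0).
    set (B := Bin b (Qe t) theta).
    replace (exp (- t) * (exp t * B)) with B by (rewrite <- Rmult_assoc, Ee; ring).
    unfold W; fold B; unfold Qe; ring.
Qed.

Lemma is_derive_nondecreasing (f df : R -> R) x y : x <= y ->
  (forall t, x <= t <= y -> is_derive f t (df t)) ->
  (forall t, x <= t <= y -> 0 <= df t) -> f x <= f y.
Proof.
intros Hxy D P; destruct (Req_dec x y) as [->|Hne]; [lra|].
destruct (MVT_cor2 f df x y) as [c [E Hc]]; [lra| |].
- intros c Hc; now apply is_derive_Reals, D.
- assert (0 <= df c) by (apply P; lra); nra.
Qed.

Lemma is_derive_increasing (f df : R -> R) x y : x < y ->
  (forall t, x <= t <= y -> is_derive f t (df t)) ->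
  (forall t, x <= t <= y -> 0 < df t) -> f x < f y.
Proof.
intros Hxy D P.
destruct (MVT_cor2 f df x y) as [c [E Hc]]; auto.
- intros c Hc; now apply is_derive_Reals, D.
- assert (0 < df c) by (apply P; lra); nra.
Qed.

(** The integral is oriented, so the time is negative for [q < p] when [w] is positive; this lets a
    reference point lie on either side of [q]. *)
Definition hitting_time (w : R -> R) (p q : R) : R := RInt (fun s => / w s) p q.

Lemma is_derive_hitting_time (w : R -> R) x0 x1 p q :
  (forall s, x0 < s < x1 -> continuous w s /\ 0 < w s) ->
  x0 < p < x1 -> x0 < q < x1 ->
  is_derive (hitting_time w p) q (/ w q).
Proof.
intros Hw Hp Hq.
assert (C : forall s, x0 < s < x1 -> continuous (fun s => / w s) s).
{ intros s Hs; destruct (Hw s Hs).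
  apply continuous_Rinv_comp; auto; lra. }
apply (is_derive_RInt (V := R_NormedModule) (fun s => / w s) _ p); auto.
assert (d0 : 0 < Rmin (q - x0) (x1 - q)) by (apply Rmin_glb_lt; lra).
exists (mkposreal _ d0); intros z Hz.
change (Rabs (z - q) < Rmin (q - x0) (x1 - q)) in Hz.
apply (RInt_correct (V := R_CompleteNormedModule)).
apply (ex_RInt_continuous (V := R_CompleteNormedModule)); intros s Hs; apply C.
generalize (Rmin_l (q - x0) (x1 - q)) (Rmin_r (q - x0) (x1 - q)).
apply Rabs_def2 in Hz; revert Hs; unfold Rmin at 1, Rmax.
destruct (Rle_dec p z); lra.
Qed.

Lemma hitting_time_increasing (w : R -> R) x0 x1 p q q' :
  (forall s, x0 < s < x1 -> continuous w s /\ 0 < w s) ->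
  x0 < p < x1 -> x0 < q -> q < q' -> q' < x1 ->
  hitting_time w p q < hitting_time w p q'.
Proof.
intros Hw Hp Hq Hqq Hq'.
apply is_derive_increasing with (fun s => / w s); auto.
- intros t Ht; apply is_derive_hitting_time with x0 x1; auto; lra.
- intros t Ht; apply Rinv_0_lt_compat, Hw; lra.
Qed.

Lemma W_le m k p q : (k < m)%nat -> 0 < p < 1 -> 0 <= q <= 1 ->
  W m (S k) p q <= 1 - q.
Proof.
intros Hk Hp Hq; destruct (Req_dec q 1) as [->|Hne].
- rewrite W_1 by lia; lra.
- generalize (Bin_lt_1 m k q Hk); unfold W; nra.
Qed.

(* Since [W q <= 1 - q], the quantity [(1 - Q t) * exp t] is nondecreasing, so
   the fixed point 1 is not reached in finite time. *)
Lemma occupation_hitting_time b k p Q : (k < b)%nat -> 0 < p < 1 ->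
  is_occupation_prob b (S k) p Q ->
  (forall q, 0 <= q < 1 -> 0 < W b (S k) p q) ->
  forall t, 0 <= t ->
    p <= Q t < 1 /\ hitting_time (W b (S k) p) p (Q t) = t.
Proof.
intros Hk Hp HQ PW t Ht.
destruct (occupation_ode _ _ _ _ HQ) as [Qe [EQ [Q0 DQ]]].
assert (B : forall s, 0 <= s -> 0 <= Qe s <= 1).
{ intros s Hs; rewrite EQ by auto; now apply HQ. }
assert (L : forall s, 0 <= s -> Qe s < 1).
{ intros s Hs.
  assert ((1 - Qe 0) * exp 0 <= (1 - Qe s) * exp s) as M.
  { apply (is_derive_nondecreasing (fun s => (1 - Qe s) * exp s)
      (fun s => (1 - Qe s - W b (S k) p (Qe s)) * exp s)); auto.
    - intros z Hz; auto_derive.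
      + exists (W b (S k) p (Qe z)); apply DQ; lra.
      + replace (Derive (fun x => Qe x) z) with (W b (S k) p (Qe z))
          by (symmetry; apply is_derive_unique, DQ; lra).
        ring.
    - intros z Hz; apply Rmult_le_pos; [|left; apply exp_pos].
      assert (W b (S k) p (Qe z) <= 1 - Qe z) by (apply W_le; auto; apply B; lra).
      lra. }
  rewrite Q0, exp_0 in M; generalize (exp_pos s); nra. }
assert (G : forall s, 0 <= s -> p <= Qe s).
{ intros s Hs; rewrite <- Q0.
  apply (is_derive_nondecreasing Qe (fun s => W b (S k) p (Qe s))); auto.
  - intros z Hz; apply DQ; lra.
  - intros z Hz; left; apply PW; split; [apply B|apply L]; lra. }
rewrite <- EQ by auto; split; [auto|].
set (T := hitting_time (W b (S k) p) p).
(* Along the solution the factors [w] and [1 / w] of the chain rule cancel, so [T (Qe s)] grows at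
   unit speed from 0. *)
assert (DT : forall s, 0 <= s -> is_derive (fun s => T (Qe s)) s 1).
{ intros s Hs.
  assert (0 < W b (S k) p (Qe s)) by (apply PW; split; [apply B|apply L]; lra).
  replace 1 with (W b (S k) p (Qe s) * / W b (S k) p (Qe s)) by (field; lra).
  apply (is_derive_comp T Qe); [|now apply DQ].
  apply (is_derive_hitting_time _ 0 1); auto.
  - intros z Hz; split; [apply is_poly_continuous, is_poly_W|apply PW; lra].
  - generalize (L s Hs) (G s Hs); lra. }
destruct (Req_dec t 0) as [->|Hne].
- unfold T; rewrite Q0; unfold hitting_time.
  now rewrite (RInt_point (V := R_CompleteNormedModule)).
- destruct (MVT_cor2 (fun s => T (Qe s)) (fun _ => 1) 0 t) as [c [E _]]; [lra| |].
  + intros c Hc; apply is_derive_Reals, DT; lra.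
  + rewrite Q0 in E; unfold T in E at 2; unfold hitting_time in E.
    rewrite (RInt_point (V := R_CompleteNormedModule)) in E.
    change (zero : R) with 0 in E; lra.
Qed.

(** At time [T q] the previous lemma gives [T (Q (T q)) = T q], and [T] is injective because it is
    strictly increasing. *)
Lemma occupation_at_hitting_time b k p Q q : (k < b)%nat -> 0 < p < 1 ->
  is_occupation_prob b (S k) p Q ->
  (forall q, 0 <= q < 1 -> 0 < W b (S k) p q) -> p <= q < 1 ->
  0 <= hitting_time (W b (S k) p) p q
  /\ Q (hitting_time (W b (S k) p) p q) = q.
Proof.
intros Hk Hp HQ PW Hq.
set (T := hitting_time (W b (S k) p) p).
assert (C : forall s, 0 < s < 1 ->
          continuous (W b (S k) p) s /\ 0 < W b (S k) p s).
{ intros s Hs; split; [apply is_poly_continuous, is_poly_W|apply PW; lra]. }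
assert (T0 : 0 <= T q).
{ replace 0 with (T p).
  - destruct (Req_dec p q) as [->|Hne]; [lra|].
    left; apply (hitting_time_increasing _ 0 1); auto; lra.
  - unfold T, hitting_time; now rewrite (RInt_point (V := R_CompleteNormedModule)). }
split; auto.
destruct (occupation_hitting_time b k p Q Hk Hp HQ PW (T q) T0) as [B E].
fold T in E.
destruct (Rtotal_order (Q (T q)) q) as [H|[H|H]]; auto; exfalso.
- assert (T (Q (T q)) < T q)
    by (apply (hitting_time_increasing _ 0 1); auto; lra); lra.
- assert (T q < T (Q (T q)))
    by (apply (hitting_time_increasing _ 0 1); auto; lra); lra.
Qed.

(** * Autonomous equations on the line *)

(* The linear bounds on [w] make [L] diverge logarithmically at both ends. *)
Lemma inverse_flow (w L : R -> R) x0 x1 K : x0 < x1 -> 0 < K ->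
  (forall q, x0 < q < x1 -> continuous w q /\ 0 < w q) ->
  (forall q, x0 < q < x1 -> w q <= K * (q - x0) /\ w q <= K * (x1 - q)) ->
  (forall q, x0 < q < x1 -> is_derive L q (/ w q)) ->
  exists phi : R -> R,
    (forall r, x0 < phi r < x1 /\ L (phi r) = r) /\
    (forall q, x0 < q < x1 -> phi (L q) = q) /\
    (forall r, is_derive phi r (w (phi r))) /\
    is_lim phi m_infty x0 /\ is_lim phi p_infty x1.
Proof.
intros Hx K0 Hw Hlin DL.
assert (Linc : forall q q', x0 < q -> q < q' -> q' < x1 -> L q < L q').
{ intros q q' H1 H2 H3.
  apply (is_derive_increasing L (fun s => / w s)); auto.
  - intros t Ht; apply DL; lra.
  - intros t Ht; apply Rinv_0_lt_compat, Hw; lra. }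
assert (Linj : forall q q', x0 < q < x1 -> x0 < q' < x1 -> L q <= L q' -> q <= q').
{ intros q q' Hq Hq' HL; destruct (Rle_lt_dec q q') as [|Hlt]; auto.
  assert (L q' < L q) by (apply Linc; lra); lra. }
set (q0 := (x0 + x1) / 2).
assert (Hq0 : x0 < q0 < x1) by (unfold q0; lra).
assert (E1 : forall m, 0 <= m -> exp (- (K * m)) <= 1).
{ intros m Hm; rewrite <- exp_0.
  destruct (Req_dec m 0) as [->|]; [rewrite Rmult_0_r, Ropp_0; lra|].
  left; apply exp_increasing; nra. }
(* [qa m] is [q0] moved back for time [m] by [q' = K (q - x0)], and [qb m] is [q0] moved forward by
   [q' = K (x1 - q)]. These comparison flows are at least as fast as [w], so [L] changes by at least
   [m]. *)
pose (qa := fun m => x0 + (q0 - x0) * exp (- (K * m))).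
pose (qb := fun m => x1 - (x1 - q0) * exp (- (K * m))).
assert (Ba : forall m, 0 <= m -> x0 < qa m <= q0).
{ intros m Hm; unfold qa; generalize (E1 m Hm) (exp_pos (- (K * m))); nra. }
assert (Bb : forall m, 0 <= m -> q0 <= qb m < x1).
{ intros m Hm; unfold qb; generalize (E1 m Hm) (exp_pos (- (K * m))); nra. }
assert (La : forall m, 0 <= m -> L (qa m) <= L q0 - m).
{ intros m Hm; specialize (Ba m Hm).
  assert (M : L (qa m) - / K * ln (qa m - x0) <= L q0 - / K * ln (q0 - x0)).
  { apply (is_derive_nondecreasing (fun q => L q - / K * ln (q - x0))
             (fun q => / w q - / K * / (q - x0))); [lra| |].
    - intros t Ht.
      apply (is_derive_minus L (fun q => / K * ln (q - x0))); [apply DL; lra|].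
      apply (is_derive_scal (fun q => ln (q - x0))).
      auto_derive; [lra|field; lra].
    - intros t Ht; rewrite <- Rinv_mult.
      assert (x0 < t < x1) by lra.
      generalize (Rinv_le_contravar (w t) (K * (t - x0)) (proj2 (Hw t H))
                    (proj1 (Hlin t H))); lra. }
  replace (qa m - x0) with ((q0 - x0) * exp (- (K * m))) in M
    by (unfold qa; ring).
  rewrite ln_mult, ln_exp in M by (try apply exp_pos; lra).
  replace (/ K * (ln (q0 - x0) + - (K * m)))
    with (/ K * ln (q0 - x0) - m) in M by (field; lra).
  lra. }
assert (Lb : forall m, 0 <= m -> L q0 + m <= L (qb m)).
{ intros m Hm; specialize (Bb m Hm).
  assert (M : L q0 + / K * ln (x1 - q0) <= L (qb m) + / K * ln (x1 - qb m)).
  { apply (is_derive_nondecreasing (fun q => L q + / K * ln (x1 - q))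
             (fun q => / w q + / K * - / (x1 - q))); [lra| |].
    - intros t Ht.
      apply (is_derive_plus L (fun q => / K * ln (x1 - q))); [apply DL; lra|].
      apply (is_derive_scal (fun q => ln (x1 - q))).
      auto_derive; [lra|field; lra].
    - intros t Ht; rewrite <- Ropp_mult_distr_r, <- Rinv_mult.
      assert (x0 < t < x1) by lra.
      generalize (Rinv_le_contravar (w t) (K * (x1 - t)) (proj2 (Hw t H))
                    (proj2 (Hlin t H))); lra. }
  replace (x1 - qb m) with ((x1 - q0) * exp (- (K * m))) in M
    by (unfold qb; ring).
  rewrite ln_mult, ln_exp in M by (try apply exp_pos; lra).
  replace (/ K * (ln (x1 - q0) + - (K * m)))
    with (/ K * ln (x1 - q0) - m) in M by (field; lra).
  lra. }
(* Kept as a sigma type, so that [phi] is a projection and no choice is involved. The margin 1 in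
   [m] puts [r] strictly between the values of [L] at the two ends. *)
assert (S : forall r, {q | x0 < q < x1 /\ L q = r}).
{ intros r; set (m := Rabs (r - L q0) + 1).
  assert (Hm : 0 <= m) by (unfold m; generalize (Rabs_pos (r - L q0)); lra).
  assert (Hr : L q0 - m < r < L q0 + m).
  { unfold m; generalize (Rle_abs (r - L q0)) (Rle_abs (- (r - L q0))).
    rewrite Rabs_Ropp; lra. }
  destruct (Ranalysis5.IVT_interv (fun q => L q - r) (qa m) (qb m))
    as [q [Hq Eq]].
  - intros q Hq; apply continuity_pt_filterlim.
    apply (continuous_minus L (fun _ => r)); [|apply continuous_const].
    apply (ex_derive_continuous L); exists (/ w q); apply DL.
    generalize (Ba m Hm) (Bb m Hm); lra.
  - generalize (Ba m Hm) (Bb m Hm); intros Ha Hb.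
    destruct (Req_dec (qa m) (qb m)) as [E|]; [|lra].
    generalize (La m Hm) (Lb m Hm); rewrite E; lra.
  - generalize (La m Hm); lra.
  - generalize (Lb m Hm); lra.
  - exists q; generalize (Ba m Hm) (Bb m Hm); lra. }
pose (phi := fun r => proj1_sig (S r)).
assert (P : forall r, x0 < phi r < x1 /\ L (phi r) = r)
  by (intros r; apply (proj2_sig (S r))).
clearbody phi.
assert (PL : forall q, x0 < q < x1 -> phi (L q) = q).
{ intros q Hq; destruct (P (L q)) as [B E].
  apply Rle_antisym; apply Linj; auto; lra. }
assert (Plt : forall r q, x0 < q < x1 -> L q < r -> q < phi r).
{ intros r q Hq Hr; destruct (P r) as [B E].
  destruct (Rlt_le_dec q (phi r)) as [|Hle]; auto.
  destruct (Req_dec (phi r) q) as [Eq|Hne]; [rewrite <- Eq in Hr; lra|].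
  assert (L (phi r) < L q) by (apply Linc; lra); lra. }
assert (Pgt : forall r q, x0 < q < x1 -> r < L q -> phi r < q).
{ intros r q Hq Hr; destruct (P r) as [B E].
  destruct (Rlt_le_dec (phi r) q) as [|Hle]; auto.
  destruct (Req_dec (phi r) q) as [Eq|Hne]; [rewrite <- Eq in Hr; lra|].
  assert (L q < L (phi r)) by (apply Linc; lra); lra. }
exists phi; split; [exact P|split; [exact PL|split; [|split]]].
(* By the mean value theorem for [L], the difference quotient of [phi] is exactly [w c] with [c]
   between [phi r] and [phi (r + h)]. The points [q1] and [q2] confine [c] to where [w] is within
   [eps] of [w (phi r)]. *)
- intros r; apply is_derive_Reals; intros eps Heps.
  destruct (P r) as [B E].
  destruct (proj1 (filterlim_locally w (w (phi r))) (proj1 (Hw _ B))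
              (mkposreal _ Heps)) as [delta Hdelta].
  generalize (cond_pos delta); intros d0.
  set (q1 := Rmax (phi r - delta / 2) ((x0 + phi r) / 2)).
  set (q2 := Rmin (phi r + delta / 2) ((phi r + x1) / 2)).
  assert (Hq1 : x0 < q1 < phi r /\ phi r - delta / 2 <= q1).
  { repeat split.
    - eapply Rlt_le_trans; [|apply Rmax_r]; lra.
    - apply Rmax_lub_lt; lra.
    - apply Rmax_l. }
  assert (Hq2 : phi r < q2 < x1 /\ q2 <= phi r + delta / 2).
  { repeat split.
    - apply Rmin_glb_lt; lra.
    - eapply Rle_lt_trans; [apply Rmin_r|]; lra.
    - apply Rmin_l. }
  clearbody q1 q2.
  assert (L1 : L q1 < r) by (rewrite <- E at 1; apply Linc; lra).
  assert (L2 : r < L q2) by (rewrite <- E at 1; apply Linc; lra).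
  assert (g0 : 0 < Rmin (r - L q1) (L q2 - r)) by (apply Rmin_glb_lt; lra).
  exists (mkposreal _ g0); intros h Hh0 Hh; simpl in Hh.
  assert (Hr : L q1 < r + h < L q2).
  { apply Rabs_def2 in Hh.
    generalize (Rmin_l (r - L q1) (L q2 - r)) (Rmin_r (r - L q1) (L q2 - r)); lra. }
  destruct (P (r + h)) as [B' E'].
  assert (q1 < phi (r + h)) by (apply Plt; lra).
  assert (phi (r + h) < q2) by (apply Pgt; lra).
  destruct (MVT_gen L (phi r) (phi (r + h)) (fun s => / w s)) as [c [Hc Ec]].
  + intros s Hs; apply DL; revert Hs; unfold Rmin, Rmax.
    destruct (Rle_dec (phi r) (phi (r + h))); lra.
  + intros s Hs; apply continuity_pt_filterlim.
    apply (ex_derive_continuous L); exists (/ w s); apply DL.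
    revert Hs; unfold Rmin, Rmax.
    destruct (Rle_dec (phi r) (phi (r + h))); lra.
  + assert (Hcq : q1 <= c <= q2).
    { revert Hc; unfold Rmin, Rmax.
      destruct (Rle_dec (phi r) (phi (r + h))); lra. }
    assert (wc : 0 < w c) by (apply Hw; lra).
    rewrite E, E' in Ec.
    replace ((phi (r + h) - phi r) / h) with (w c).
    * apply (Hdelta c); change (Rabs (c - phi r) < delta).
      apply Rabs_def1; lra.
    * assert (Eh : phi (r + h) - phi r = h * w c).
      { replace h with (r + h - r) at 2 by ring; rewrite Ec; field; lra. }
      rewrite Eh; field; auto.
- apply is_lim_spec; intros eps; generalize (cond_pos eps); intros e0.
  set (q := Rmin (x0 + eps) q0).
  assert (Hq : x0 < q < x1 /\ q <= x0 + eps).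
  { unfold q; repeat split.
    - apply Rmin_glb_lt; lra.
    - eapply Rle_lt_trans; [apply Rmin_r|]; lra.
    - apply Rmin_l. }
  exists (L q); intros r Hr; destruct (P r) as [B E].
  assert (phi r < q) by (apply Pgt; lra).
  apply Rabs_def1; lra.
- apply is_lim_spec; intros eps; generalize (cond_pos eps); intros e0.
  set (q := Rmax (x1 - eps) q0).
  assert (Hq : x0 < q < x1 /\ x1 - eps <= q).
  { unfold q; repeat split.
    - eapply Rlt_le_trans; [|apply Rmax_r]; lra.
    - apply Rmax_lub_lt; lra.
    - apply Rmax_l. }
  exists (L q); intros r Hr; destruct (P r) as [B E].
  assert (q < phi r) by (apply Plt; lra).
  apply Rabs_def1; lra.
Qed.

(** Gronwall applied to [D = (f - g)^2], with a Lipschitz constant valid on the range of both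
    solutions between [r0] and [r]. From [|D'| <= 2 K D], the weight [exp (- 2 K t)] serves the
    forward direction and [exp (2 K t)] the backward one. *)
Lemma ode_unique w (f g : R -> R) r0 : is_poly w ->
  (forall r, is_derive f r (w (f r))) -> (forall r, is_derive g r (w (g r))) ->
  f r0 = g r0 -> forall r, f r = g r.
Proof.
intros Pw Df Dg E0 r.
assert (Cf : forall t, continuous f t).
{ intros t; apply (ex_derive_continuous f); exists (w (f t)); apply Df. }
assert (Cg : forall t, continuous g t).
{ intros t; apply (ex_derive_continuous g); exists (w (g t)); apply Dg. }
destruct (continuity_ab_maj (fun t => Rabs (f t) + Rabs (g t)) (Rmin r0 r) (Rmax r0 r))
  as [tM [HM _]].
{ apply Rle_trans with r0; [apply Rmin_l|apply Rmax_l]. }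
{ intros t _; apply continuity_pt_filterlim.
  apply (continuous_plus (fun t => Rabs (f t)) (fun t => Rabs (g t)));
    now apply continuous_Rabs_comp. }
set (M := Rabs (f tM) + Rabs (g tM)) in HM.
destruct (is_poly_lipschitz w M Pw) as [K [K0 HK]].
pose (D := fun t => (f t - g t) ^ 2).
pose (dD := fun t => 2 * (f t - g t) * (w (f t) - w (g t))).
assert (DD : forall t, is_derive D t (dD t)).
{ intros t; unfold D.
  apply is_derive_ext with (fun t => (f t - g t) * (f t - g t));
    [intros; simpl; ring|].
  replace (dD t) with ((w (f t) - w (g t)) * (f t - g t)
                       + (f t - g t) * (w (f t) - w (g t))) by (unfold dD; ring).
  apply (is_derive_mult (fun t => f t - g t) (fun t => f t - g t));
    [apply (is_derive_minus f g); auto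
    |apply (is_derive_minus f g); auto|intros; apply Rmult_comm]. }
assert (BD : forall t, Rmin r0 r <= t <= Rmax r0 r -> Rabs (dD t) <= 2 * K * D t).
{ intros t Ht; specialize (HM t Ht); simpl in HM.
  assert (L : Rabs (w (f t) - w (g t)) <= K * Rabs (f t - g t)).
  { apply HK; generalize (Rabs_pos (f t)) (Rabs_pos (g t)); lra. }
  unfold dD, D; rewrite !Rabs_mult, (Rabs_pos_eq 2) by lra.
  rewrite <- (pow2_abs (f t - g t)); generalize (Rabs_pos (f t - g t)); nra. }
assert (Dr : D r <= 0).
{ assert (Z : D r0 = 0) by (unfold D; rewrite E0; ring).
  destruct (Rle_lt_dec r0 r) as [Hr|Hr].
  - rewrite Rmin_left, Rmax_right in BD by lra.
    assert (I : - D r0 * exp (- (2 * K) * r0) <= - D r * exp (- (2 * K) * r)).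
    { apply (is_derive_nondecreasing (fun t => - D t * exp (- (2 * K) * t))
         (fun t => (2 * K * D t - dD t) * exp (- (2 * K) * t))); auto.
      - intros t Ht.
        replace ((2 * K * D t - dD t) * exp (- (2 * K) * t))
          with (- dD t * exp (- (2 * K) * t)
                + - D t * (- (2 * K) * exp (- (2 * K) * t))) by ring.
        apply (is_derive_mult (fun t => - D t) (fun t => exp (- (2 * K) * t)));
          [now apply (is_derive_opp D)| |intros; apply Rmult_comm].
        auto_derive; auto; ring.
      - intros t Ht; apply Rmult_le_pos; [|left; apply exp_pos].
        generalize (BD t Ht) (Rle_abs (dD t)); lra. }
    rewrite Z in I; generalize (exp_pos (- (2 * K) * r)); nra.
  - rewrite Rmin_right, Rmax_left in BD by lra.
    assert (I : D r * exp (2 * K * r) <= D r0 * exp (2 * K * r0)).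
    { apply (is_derive_nondecreasing (fun t => D t * exp (2 * K * t))
         (fun t => (2 * K * D t + dD t) * exp (2 * K * t))); [lra| |].
      - intros t Ht.
        replace ((2 * K * D t + dD t) * exp (2 * K * t))
          with (dD t * exp (2 * K * t) + D t * (2 * K * exp (2 * K * t))) by ring.
        apply (is_derive_mult D (fun t => exp (2 * K * t)));
          [auto| |intros; apply Rmult_comm].
        auto_derive; auto; ring.
      - intros t Ht; apply Rmult_le_pos; [|left; apply exp_pos].
        generalize (BD t Ht) (Rle_abs (- dD t)); rewrite Rabs_Ropp; lra. }
    rewrite Z in I; generalize (exp_pos (2 * K * r)); nra. }
unfold D in Dr; generalize (pow2_ge_0 (f r - g r)); intros.
assert (f r - g r = 0); [|lra].
apply Rsqr_0_uniq; rewrite Rsqr_pow2; lra.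
Qed.

(** * The limit near the transition *)

Lemma is_transition_tangency b theta pT qT : is_transition b theta pT qT ->
  0 < pT < 1 /\ local_minimizer01 (W b theta pT) qT /\ W b theta pT qT = 0.
Proof.
intros [pt [qmin [[Hpt [Hq _]] [[[HpT HW] _] ->]]]].
split; [lra|split; auto].
now apply Hq.
Qed.

(** Puts the bottleneck strictly after the starting point: at a root, [q] is [p] plus a positive
    multiple of [Bin]. *)
Lemma W_root_gt b k p q : (k < b)%nat -> 0 < p < 1 -> 0 < q < 1 ->
  W b (S k) p q = 0 -> p < q.
Proof. intros Hk Hp Hq; generalize (Bin_pos b k q Hk); unfold W; nra. Qed.

(** After translating [qT] to 0, the passage estimate applies with starting point [pT]. The true
    start [pT + h] depends on [h], but the piece from [pT] to [pT + h] vanishes in the limit, as the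
    drift is bounded below near [pT]. *)
Lemma hitting_time_asympt b k pT qT q :
  (1 <= k)%nat -> (S k < b)%nat -> 0 < pT < 1 ->
  local_minimizer01 (W b (S k) pT) qT -> W b (S k) pT qT = 0 -> qT < q < 1 ->
  exists L, filterlim
    (fun h => hitting_time (W b (S k) (pT + h)) (pT + h) q
              - alpha b (S k) pT qT * / sqrt h) (at_right 0) (locally L).
Proof.
intros Hk Hb Hp Hmin HW Hq.
destruct (W_at_tangency b (S k) pT qT) as [w1 [w2 [D1 [D2 [Z1 [a0 PW]]]]]];
  auto; [lia|].
destruct Hmin as [HqT _].
assert (HpT : pT < qT) by (apply (W_root_gt b k); auto; lia).
set (w := W b (S k) pT) in *.
pose (H := fun s => 1 - Bin b s (S k)).
assert (PH : is_poly H).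
{ apply is_poly_minus; [apply is_poly_const|apply is_poly_Bin]. }
assert (Pw : is_poly w) by apply is_poly_W.
assert (H0 : forall s, 0 <= s < 1 -> 0 < H s).
{ intros s Hs; unfold H; generalize (Bin_lt_1 b k s ltac:(lia) Hs); lra. }
assert (w0 : forall s, 0 <= s < 1 -> 0 <= w s).
{ intros s Hs; destruct (Req_dec s qT) as [->|]; [lra|left; auto]. }
assert (EW : forall h s, W b (S k) (pT + h) s = w s + h * H s).
{ intros h s; apply W_shift. }
assert (PWh : forall h s, 0 < h -> 0 <= s < 1 -> 0 < w s + h * H s).
{ intros h s Hh Hs; generalize (H0 s Hs) (w0 s Hs); nra. }
assert (Ih : forall h s t, 0 < h -> 0 <= s -> s <= t -> t < 1 ->
          ex_RInt (fun s => / (w s + h * H s)) s t).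
{ intros h s t Hh Hs Hst Ht.
  apply (ex_RInt_continuous (V := R_CompleteNormedModule)); intros z Hz.
  rewrite Rmin_left, Rmax_right in Hz by lra.
  apply (continuous_Rinv_comp (fun s => w s + h * H s)).
  - apply (is_poly_continuous (fun s => w s + h * H s)).
    apply is_poly_plus; auto; apply is_poly_mult; auto; apply is_poly_const.
  - apply Rgt_not_eq, PWh; lra. }
(* [W_pT(qT) = 0] rearranges to [(1 - pT) H(qT) = 1 - qT]. The second square root in [alpha] is thus
   that of [1 / H(qT)], which gives the form [PI / sqrt (a * c)]. *)
assert (Ealpha : alpha b (S k) pT qT = PI / sqrt (w2 qT / 2 * H qT)).
{ assert (E2 : Derive_n w 2 qT = w2 qT).
  { simpl; apply is_derive_unique; apply is_derive_ext with w1; auto.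
    intros t; symmetry; now apply is_derive_unique. }
  assert (EH : (1 - pT) / (1 - qT) = / H qT).
  { assert (E : (1 - pT) * H qT = 1 - qT) by (revert HW; unfold w, W, H; lra).
    assert (0 < H qT) by (apply H0; lra).
    rewrite <- E; field; lra. }
  assert (0 < H qT) by (apply H0; lra).
  unfold alpha; fold w; rewrite E2, EH.
  replace (1 / 2 * w2 qT) with (w2 qT / 2) by field.
  rewrite sqrt_mult, sqrt_inv by lra.
  field; split; apply Rgt_not_eq, sqrt_lt_R0; lra. }
destruct (is_poly_taylor w w1 (w2 qT) qT Pw D1 (D2 qT)) as [e [g [Pg Eg]]].
destruct (is_poly_derive H PH) as [H1 [PH1 DH1]].
destruct (is_poly_derive H1 PH1) as [H2 [PH2 DH2]].
destruct (is_poly_taylor H H1 (H2 qT) qT PH DH1 (DH2 qT)) as [e' [g' [Pg' Eg']]].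
destruct (passage_time_asympt (fun x => w (qT + x)) (fun x => H (qT + x)) g
   (fun x => H2 qT / 2 + e' * x + x ^ 2 * g' x)
   (w2 qT / 2) (H qT) e (H1 qT) (pT - qT) (q - qT)) as [L HL].
{ lra. }
{ apply H0; lra. }
{ lra. }
{ auto. }
{ apply is_poly_plus; [apply is_poly_plus; [apply is_poly_const|]|].
  - apply is_poly_mult; [apply is_poly_const|apply is_poly_id].
  - apply is_poly_mult; auto; apply (is_poly_pow (fun x => x)), is_poly_id. }
{ intros x; rewrite Eg, Z1, HW; ring. }
{ intros x; rewrite Eg'; ring. }
{ intros x Hx Hne; apply PW; lra. }
{ intros x Hx; apply H0; lra. }
rewrite <- Ealpha in HL.
exists L.
apply filterlim_ext_loc with
  (fun h => (RInt (fun x => / (w (qT + x) + h * H (qT + x))) (pT - qT) (q - qT)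
             - alpha b (S k) pT qT * / sqrt h)
            + - RInt (fun s => / (w s + h * H s)) pT (pT + h)).
{ assert (d0 : 0 < q - pT) by lra.
  exists (mkposreal _ d0); intros h Hh h0.
  change (Rabs (h - 0) < q - pT) in Hh; apply Rabs_def2 in Hh.
  unfold hitting_time.
  rewrite (RInt_ext (V := R_CompleteNormedModule)
             (fun s => / W b (S k) (pT + h) s) (fun s => / (w s + h * H s)))
    by (intros; now rewrite EW).
  pose proof (RInt_Chasles (V := R_CompleteNormedModule)
    (fun s => / (w s + h * H s)) pT (pT + h) q
    ltac:(apply Ih; lra) ltac:(apply Ih; lra)) as EC.
  pose proof (RInt_comp_lin (V := R_CompleteNormedModule)
    (fun s => / (w s + h * H s)) 1 qT (pT - qT) (q - qT)) as EL.
  replace (1 * (pT - qT) + qT) with pT in EL by ring.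
  replace (1 * (q - qT) + qT) with q in EL by ring.
  specialize (EL ltac:(apply Ih; lra)).
  rewrite <- EC in EL; clear EC.
  rewrite (RInt_ext (V := R_CompleteNormedModule) _
    (fun x => / (w (qT + x) + h * H (qT + x)))) in EL.
  - rewrite EL; unfold plus; simpl; ring.
  - intros x _; unfold scal; simpl; unfold mult; simpl.
    replace (1 * x + qT) with (qT + x) by ring; ring. }
replace L with (plus L 0) by (unfold plus; simpl; ring).
refine (filterlim_comp_2 _ _ Rplus HL _ (filterlim_plus (V := R_NormedModule) _ _)).
assert (wp : 0 < w pT) by (apply PW; lra).
assert (C : continuous w pT) by now apply is_poly_continuous.
(* Near [pT] the drift exceeds [w pT / 2], so the short piece takes time at most
   [h / (w pT / 2)]. *)
assert (e0 : 0 < w pT / 2) by lra.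
destruct (proj1 (filterlim_locally w (w pT)) C (mkposreal _ e0)) as [delta Hdelta].
apply filterlim_locally; intros eps.
generalize (cond_pos eps) (cond_pos delta); intros eps0 delta0.
assert (d0 : 0 < Rmin (qT - pT) (Rmin delta (eps * (w pT / 2)))).
{ repeat apply Rmin_glb_lt; nra. }
exists (mkposreal _ d0); intros h Hh h0.
change (Rabs (h - 0) < Rmin (qT - pT) (Rmin delta (eps * (w pT / 2)))) in Hh.
rewrite Rminus_0_r, Rabs_pos_eq in Hh by lra.
assert (Hh' : h < qT - pT /\ h < delta /\ h < eps * (w pT / 2)).
{ generalize (Rmin_l (qT - pT) (Rmin delta (eps * (w pT / 2))))
    (Rmin_r (qT - pT) (Rmin delta (eps * (w pT / 2))))
    (Rmin_l delta (eps * (w pT / 2))) (Rmin_r delta (eps * (w pT / 2))); lra. }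
change (Rabs (- RInt (fun s => / (w s + h * H s)) pT (pT + h) - 0) < eps).
rewrite Rminus_0_r, Rabs_Ropp.
eapply Rle_lt_trans.
- apply (abs_RInt_le_const _ pT (pT + h) (/ (w pT / 2))); [lra|apply Ih; lra|].
  intros s Hs.
  assert (B : Rabs (w s - w pT) < w pT / 2).
  { apply (Hdelta s); change (Rabs (s - pT) < delta); apply Rabs_def1; lra. }
  apply Rabs_def2 in B.
  assert (0 < H s) by (apply H0; lra).
  rewrite Rabs_pos_eq by (left; apply Rinv_0_lt_compat; nra).
  apply Rinv_le_contravar; nra.
- apply Rmult_lt_reg_r with (w pT / 2); auto.
  rewrite Rmult_assoc, Rinv_l by lra; lra.
Qed.

(** [RInt_perturbed_limit] for endpoints in either order: reversing them negates both sides. *)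
Lemma hitting_time_perturbed_limit (w H : R -> R) x0 x1 p q :
  (forall s, x0 < s < x1 -> continuous w s /\ continuous H s) ->
  (forall s, x0 < s < x1 -> 0 < w s /\ 0 <= H s) ->
  x0 < p < x1 -> x0 < q < x1 ->
  filterlim (fun h => hitting_time (fun s => w s + h * H s) p q)
    (at_right 0) (locally (hitting_time w p q)).
Proof.
intros HC HP Hp Hq.
assert (main : forall p q, x0 < p -> p <= q -> q < x1 ->
  filterlim (fun h => hitting_time (fun s => w s + h * H s) p q)
    (at_right 0) (locally (hitting_time w p q))).
{ clear p q Hp Hq; intros p q Hp Hpq Hq; apply RInt_perturbed_limit; auto.
  - intros s Hs; apply HC; lra.
  - intros s Hs; apply HP; lra. }
destruct (Rle_lt_dec p q) as [Hpq|Hpq]; [apply main; lra|].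
assert (I : forall h, 0 <= h -> ex_RInt (fun s => / (w s + h * H s)) q p).
{ intros h Hh; apply (ex_RInt_continuous (V := R_CompleteNormedModule)); intros s Hs.
  rewrite Rmin_left, Rmax_right in Hs by lra.
  destruct (HC s) as [C1 C2]; [lra|].
  destruct (HP s) as [B1 B2]; [lra|].
  apply (continuous_Rinv_comp (fun s => w s + h * H s)).
  - apply (continuous_plus w (fun s => h * H s)); auto.
    apply (continuous_mult (fun _ => h) H); auto; apply continuous_const.
  - nra. }
assert (swap : forall h, 0 <= h -> hitting_time (fun s => w s + h * H s) p q
                          = opp (hitting_time (fun s => w s + h * H s) q p)).
{ intros h Hh; unfold hitting_time; symmetry.
  apply (opp_RInt_swap (V := R_CompleteNormedModule)), I, Hh. }
assert (swap0 : hitting_time w p q = opp (hitting_time w q p)).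
{ unfold hitting_time; symmetry.
  apply (opp_RInt_swap (V := R_CompleteNormedModule)).
  apply (ex_RInt_ext (V := R_NormedModule)) with (fun s => / (w s + 0 * H s)).
  - intros; f_equal; ring.
  - apply I; lra. }
rewrite swap0.
apply filterlim_ext_loc
  with (fun h => opp (hitting_time (fun s => w s + h * H s) q p)).
- exists (mkposreal _ Rlt_0_1); intros h _ h0; symmetry; apply swap; lra.
- refine (filterlim_comp _ _ _ _ opp _ _ _ (main q p _ _ _)
            (filterlim_opp (V := R_NormedModule) _)); lra.
Qed.

Theorem theorem2p5 (b theta : nat) (htheta : (2 <= theta)%nat)
    (hb : (theta < b)%nat)
    (pT qT : R) (hT : is_transition b theta pT qT)
    (Q : R -> R -> R)
    (hQ : forall p, 0 < p < 1 -> is_occupation_prob b theta p (Q p)) :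
  exists phi phi_inv : R -> R,
    (forall r : R,
       filterlim (fun h => Q (pT + h) (alpha b theta pT qT * / sqrt h + r))
         (at_right 0) (locally (phi r))) /\
    solves_bvp b theta pT qT phi /\
    (forall psi : R -> R, solves_bvp b theta pT qT psi ->
       exists c : R, forall r : R, psi r = phi (r + c)) /\
    (forall r : R, qT < phi r < 1 /\ phi_inv (phi r) = r) /\
    (forall q : R, qT < q < 1 ->
       phi (phi_inv q) = q /\
       at_right 0 (fun h => exists! t : R, 0 <= t /\ Q (pT + h) t = q) /\
       forall t_ : R -> R,
         at_right 0 (fun h => 0 <= t_ h /\ Q (pT + h) (t_ h) = q) ->
         filterlim (fun h => t_ h - alpha b theta pT qT * / sqrt h)
           (at_right 0) (locally (phi_inv q))).
Proof.
destruct (is_transition_tangency _ _ _ _ hT) as [Hp [Hmin HW]].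
destruct theta as [|k]; [lia|].
assert (Hk : (k < b)%nat) by lia.
destruct (W_at_tangency b (S k) pT qT) as [_ [_ [_ [_ [_ [_ PW]]]]]]; auto.
pose proof Hmin as [HqT _].
assert (HpT : pT < qT) by (apply (W_root_gt b k); auto).
set (w := W b (S k) pT) in *.
pose (T := fun h q => hitting_time (W b (S k) (pT + h)) (pT + h) q).
set (al := alpha b (S k) pT qT).
assert (Cw : forall p s, continuous (W b (S k) p) s).
{ intros p s; apply is_poly_continuous, is_poly_W. }
assert (Pw : forall s, qT < s < 1 -> continuous w s /\ 0 < w s).
{ intros s Hs; split; [apply Cw|apply PW; lra]. }
assert (PWh : forall h, 0 < h -> forall s, 0 <= s < 1 -> 0 < W b (S k) (pT + h) s).
{ intros h Hh s Hs; rewrite W_shift; fold w.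
  assert (0 < h * (1 - Bin b s (S k))).
  { apply Rmult_lt_0_compat; auto; generalize (Bin_lt_1 b k s Hk Hs); lra. }
  destruct (Req_dec s qT) as [->|Hne]; [lra|].
  generalize (PW s Hs Hne); lra. }
pose (H := fun s => 1 - Bin b s (S k)).
set (q0 := (qT + 1) / 2).
assert (Hq0 : qT < q0 < 1) by (unfold q0; lra).
assert (Hpq0 : pT < q0) by lra.
destruct (hitting_time_asympt b k pT qT q0) as [L0 HL0]; auto; [lia|].
fold al in HL0.
(* The asymptotics are invoked only at [q0]; limits taken separately for each [q] would be unrelated
   numbers. Anchored this way, [L] is visibly an antiderivative of [1 / w], and the time from [q0]
   to [q] converges without correction. *)
pose (L := fun q => L0 + hitting_time w q0 q).
assert (DL : forall q, qT < q < 1 -> is_derive L q (/ w q)).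
{ intros q Hq; rewrite <- (Rplus_0_l (/ w q)).
  apply (is_derive_plus (fun _ => L0) (hitting_time w q0)).
  - apply (@is_derive_const R_AbsRing).
  - apply (is_derive_hitting_time _ qT 1); auto. }
assert (small : forall q, pT < q -> at_right 0 (fun h => 0 < h /\ pT + h < q)).
{ intros q Hq; assert (d0 : 0 < q - pT) by lra.
  exists (mkposreal _ d0); intros h Hh h0; split; auto.
  change (Rabs (h - 0) < q - pT) in Hh; apply Rabs_def2 in Hh; lra. }
assert (HL : forall q, qT < q < 1 ->
          filterlim (fun h => T h q - al * / sqrt h) (at_right 0) (locally (L q))).
{ intros q Hq.
  apply filterlim_ext_loc with (fun h => (T h q0 - al * / sqrt h)
      + hitting_time (fun s => w s + h * H s) q0 q).
  - generalize (filter_and _ _ (small q0 Hpq0) (small q (Rlt_trans _ _ _ HpT (proj1 Hq)))).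
    apply filter_imp; intros h [[Hh H1] [_ H2]].
    assert (E : T h q0 + hitting_time (fun s => w s + h * H s) q0 q = T h q); [|lra].
    unfold T, hitting_time.
    rewrite (RInt_ext (V := R_CompleteNormedModule) (fun s => / (w s + h * H s))
               (fun s => / W b (S k) (pT + h) s))
      by (intros; now rewrite W_shift).
    assert (I : forall x y, 0 < x < 1 -> 0 < y < 1 ->
              ex_RInt (fun s => / W b (S k) (pT + h) s) x y).
    { intros x y Hx Hy.
      apply (ex_RInt_continuous (V := R_CompleteNormedModule)); intros s Hs.
      apply continuous_Rinv_comp; [apply Cw|].
      apply Rgt_not_eq, PWh; auto.
      revert Hs; unfold Rmin, Rmax; destruct (Rle_dec x y); lra. }
    apply (RInt_Chasles (V := R_CompleteNormedModule)); apply I; lra.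
  - refine (filterlim_comp_2 _ _ Rplus HL0 _ (filterlim_plus (V := R_NormedModule) _ _)).
    apply (hitting_time_perturbed_limit w H qT 1); auto.
    + intros s Hs; split; [apply Cw|].
      apply (is_poly_continuous H), is_poly_minus;
        [apply is_poly_const|apply is_poly_Bin].
    + intros s Hs; split; [now apply Pw|].
      unfold H; generalize (Bin_lt_1 b k s Hk); lra. }
(* The Lipschitz bound with [w qT = 0] handles the lower end and [w q <= 1 - q] the upper one;
   [K + 1] covers both and is positive. *)
destruct (is_poly_lipschitz w 1 (is_poly_W _ _ _)) as [K [K0 HK]].
destruct (inverse_flow w L qT 1 (K + 1)) as [phi [P1 [P2 [P3 [P4 P5]]]]]; auto.
{ lra. }
{ lra. }
{ intros q Hq; split.
  - assert (A : Rabs (w q - w qT) <= K * Rabs (q - qT))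
      by (apply HK; apply Rabs_le; lra).
    rewrite HW, Rminus_0_r, (Rabs_pos_eq (q - qT)) in A by lra.
    generalize (Rle_abs (w q)); lra.
  - assert (w q <= 1 - q) by (apply W_le; auto; lra); nra. }
assert (Linc : forall q q', qT < q -> q < q' -> q' < 1 -> L q < L q').
{ intros q q' H1 H2 H3.
  apply (is_derive_increasing L (fun s => / w s)); auto.
  - intros t Ht; apply DL; lra.
  - intros t Ht; apply Rinv_0_lt_compat, Pw; lra. }
assert (Hit : forall h t, 0 < h -> pT + h < 1 -> 0 <= t ->
          pT + h <= Q (pT + h) t < 1 /\ T h (Q (pT + h) t) = t).
{ intros h t Hh Hh1 Ht; apply occupation_hitting_time; auto; try lra.
  apply hQ; lra. }
assert (Hat : forall h q, 0 < h -> pT + h <= q < 1 ->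
          0 <= T h q /\ Q (pT + h) (T h q) = q).
{ intros h q Hh Hq; apply occupation_at_hitting_time; auto; try lra.
  apply hQ; lra. }
assert (Tinc : forall h q q', 0 < h -> pT + h < 1 -> pT + h <= q -> q < q' -> q' < 1 ->
          T h q < T h q').
{ intros h q q' Hh Hh1 H1 H2 H3; apply (hitting_time_increasing _ 0 1); auto; try lra.
  intros s Hs; split; [apply Cw|apply PWh; lra]. }
exists phi, L; split; [|split; [|split; [|split]]].
- intros r; apply filterlim_locally; intros eps; generalize (cond_pos eps); intros e0.
  destruct (P1 r) as [B E].
  (* Since [L q1 < r < L q2], for small [h] the time [t] lies strictly between the hitting times of
     [q1] and [q2], which traps [Q (pT + h) t] between these two levels. The first hitting time also
     shows that [t] is nonnegative. *)
  set (q1 := Rmax (phi r - eps / 2) ((qT + phi r) / 2)).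
  set (q2 := Rmin (phi r + eps / 2) ((phi r + 1) / 2)).
  assert (Hq1 : qT < q1 < phi r /\ phi r - eps / 2 <= q1).
  { repeat split.
    - eapply Rlt_le_trans; [|apply Rmax_r]; lra.
    - apply Rmax_lub_lt; lra.
    - apply Rmax_l. }
  assert (Hq2 : phi r < q2 < 1 /\ q2 <= phi r + eps / 2).
  { repeat split.
    - apply Rmin_glb_lt; lra.
    - eapply Rle_lt_trans; [apply Rmin_r|]; lra.
    - apply Rmin_l. }
  clearbody q1 q2.
  assert (L1 : L q1 < r) by (rewrite <- E at 1; apply Linc; lra).
  assert (L2 : r < L q2) by (rewrite <- E at 1; apply Linc; lra).
  assert (A1 : qT < q1 < 1) by lra.
  assert (A2 : qT < q2 < 1) by lra.
  assert (A3 : pT < q1) by lra.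
  assert (e1 : 0 < r - L q1) by lra; assert (e2 : 0 < L q2 - r) by lra.
  pose proof (proj1 (filterlim_locally _ _) (HL q1 A1) (mkposreal _ e1)) as F1.
  pose proof (proj1 (filterlim_locally _ _) (HL q2 A2) (mkposreal _ e2)) as F2.
  generalize (filter_and _ _ (small q1 A3) (filter_and _ _ F1 F2)).
  apply filter_imp; intros h [[Hh Hh1] [G1 G2]].
  change (Rabs (T h q1 - al * / sqrt h - L q1) < r - L q1) in G1.
  change (Rabs (T h q2 - al * / sqrt h - L q2) < L q2 - r) in G2.
  apply Rabs_def2 in G1, G2.
  set (t := al * / sqrt h + r).
  assert (Ht : T h q1 < t < T h q2) by (unfold t; lra).
  destruct (Hat h q1) as [Hat1 _]; [auto|lra|].
  destruct (Hit h t) as [BQ EQ]; [auto|lra|lra|].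
  assert (q1 < Q (pT + h) t).
  { destruct (Rlt_le_dec q1 (Q (pT + h) t)) as [|[Hlt|Heq]]; auto; exfalso.
    - assert (T h (Q (pT + h) t) < T h q1) by (apply Tinc; lra); lra.
    - rewrite Heq in EQ; lra. }
  assert (Q (pT + h) t < q2).
  { destruct (Rlt_le_dec (Q (pT + h) t) q2) as [|[Hlt|Heq]]; auto; exfalso.
    - assert (T h q2 < T h (Q (pT + h) t)) by (apply Tinc; lra); lra.
    - rewrite <- Heq in EQ; lra. }
  change (Rabs (Q (pT + h) t - phi r) < eps); apply Rabs_def1; lra.
- split; [exact P3|split; auto].
- intros psi [D3 [D4 D5]].
  assert (Cpsi : continuity psi).
  { intros t; apply continuity_pt_filterlim.
    apply (ex_derive_continuous psi); exists (w (psi t)); apply D3. }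
  apply is_lim_spec in D4; apply is_lim_spec in D5.
  assert (g0 : 0 < (1 - qT) / 2) by lra.
  destruct (D4 (mkposreal _ g0)) as [m Hm], (D5 (mkposreal _ g0)) as [M HM].
  assert (Bm : psi (m - 1) < q0).
  { assert (A : Rabs (psi (m - 1) - qT) < (1 - qT) / 2) by (apply Hm; lra).
    apply Rabs_def2 in A; unfold q0; lra. }
  assert (BM : q0 < psi (M + 1)).
  { assert (A : Rabs (psi (M + 1) - 1) < (1 - qT) / 2) by (apply HM; lra).
    apply Rabs_def2 in A; unfold q0; lra. }
  destruct (IVT_gen psi (m - 1) (M + 1) q0 Cpsi) as [r0 [_ Hr0]].
  { rewrite Rmin_left, Rmax_right; lra. }
  (* The boundary limits force [psi] through the level [q0], at [r0]; [phi] takes that value at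
     [L q0], so this shift makes the two solutions agree at [r0]. *)
  exists (L q0 - r0).
  apply (ode_unique w psi (fun r => phi (r + (L q0 - r0))) r0).
  + apply is_poly_W.
  + exact D3.
  + intros r; rewrite <- (Rmult_1_l (w _)).
    apply (is_derive_comp phi (fun r => r + (L q0 - r0))); [apply P3|].
    auto_derive; auto; ring.
  + replace (r0 + (L q0 - r0)) with (L q0) by ring.
    now rewrite P2.
- exact P1.
- intros q Hq; split; [auto|split]; assert (Hpq : pT < q) by lra.
  + generalize (small q Hpq); apply filter_imp; intros h [Hh Hh1].
    destruct (Hat h q) as [T0 TQ]; [auto|lra|].
    exists (T h q); split; auto.
    intros t [Ht Et].
    (* The hitting-time identity determines [t] from the level reached, so existence came from [Hat]
       and uniqueness comes from [Hit]. *)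
    destruct (Hit h t) as [_ E]; [auto|lra|auto|]; now rewrite Et in E.
  + intros t_ Ht_; apply filterlim_ext_loc with (fun h => T h q - al * / sqrt h);
      [|auto].
    generalize (filter_and _ _ (small q Hpq) Ht_); apply filter_imp.
    intros h [[Hh Hh1] [Ht Et]].
    destruct (Hit h (t_ h)) as [_ E]; [auto|lra|auto|]; rewrite Et in E.
    now rewrite E.
Qed.
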